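(* Thompson's group $F$ is invariably generated by $\{x_0,x_1,x_0x_1\}$; that is, for every choice of $g_1,g_2,g_3\in F$, the elements $x_0^{g_1},x_1^{g_2},(x_0x_1)^{g_3}$ generate $F$.
   Context: Thompson's group $F$ is the group of all piecewise linear homeomorphisms of $[0,1]$ with finitely many breakpoints, all at finite dyadic fractions, and all slopes integer powers of $2$; composition is from left to right and $a^g=g^{-1}ag$. Writing points of $(0,1)$ as binary expansions $.s$, $x_0$ maps $.00\alpha\mapsto .0\alpha$, $.01\alpha\mapsto .10\alpha$, $.1\alpha\mapsto .11\alpha$, and $x_1$ maps $.0\alpha\mapsto .0\alpha$, $.100\alpha\mapsto .10\alpha$, $.101\alpha\mapsto .110\alpha$, $.11\alpha\mapsto .111\alpha$, for every infinite binary word $\alpha$. A subset $S$ of a group $G$ invariably generates $G$ if $G=\langle s^{g(s)}: s\in S\rangle$ for every choice of $g(s)\in G$, $s\in S$. *)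

(* Defs.v *)
From Stdlib Require Import Reals ZArith.
Open Scope R_scope.

Definition dyadic (x : R) : Prop := exists (m : Z) (n : nat), x = IZR m / 2 ^ n.

(* Elements of F are represented as maps R -> R that are the identity outside
   [0,1] (so that equality of elements is equality of functions).  On [0,1]:
   there are breakpoints 0 = a 0 < a 1 < ... < a n = 1, all dyadic, f(0)=0,
   f(1)=1, and on each [a i, a (i+1)] f is affine with slope 2^k, k : Z
   (hence f is an increasing PL homeomorphism of [0,1]). *)
Definition inF (f : R -> R) : Prop :=
  (forall x, x < 0 \/ 1 < x -> f x = x) /\
  f 0 = 0 /\ f 1 = 1 /\
  exists (n : nat) (a : nat -> R),
    a 0%nat = 0 /\ a n = 1 /\
    (forall i, (i <= n)%nat -> dyadic (a i)) /\
    (forall i, (i < n)%nat ->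
       a i < a (S i) /\
       exists k : Z, forall x, a i <= x <= a (S i) ->
         f x = f (a i) + powerRZ 2 k * (x - a i)).

Definition mulF (f g : R -> R) : R -> R := fun x => g (f x).

Definition conjF (a g ginv : R -> R) : R -> R := mulF (mulF ginv a) g.

Inductive gen (S : (R -> R) -> Prop) : (R -> R) -> Prop :=
| gen_base s : S s -> gen S s
| gen_id : gen S (fun x => x)
| gen_mul f g : gen S f -> gen S g -> gen S (mulF f g)
| gen_inv f g : gen S f -> (forall x, g (f x) = x) -> (forall x, f (g x) = x) -> gen S g.

(* the generators x0, x1, read off from their binary descriptions *)
Definition x0 (x : R) : R :=
  if Rlt_dec x 0 then x
  else if Rle_dec x (1/4) then 2 * x
  else if Rle_dec x (1/2) then x + 1/4
  else if Rle_dec x 1 then x / 2 + 1/2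
  else x.

Definition x1 (x : R) : R :=
  if Rle_dec x (1/2) then x
  else if Rle_dec x (5/8) then 2 * x - 1/2
  else if Rle_dec x (3/4) then x + 1/8
  else if Rle_dec x 1 then x / 2 + 1/2
  else x.

(* Main.v *)
Require Import Defs.
From Stdlib Require Import Reals ZArith List Lra Lia FunctionalExtensionality.
Import ListNotations.
Open Scope R_scope.

(* Conjugating everything, we may assume g1 = 1, so that H contains x0.  Identify the circle of
   x0-orbits in (0,1) with the interval .01.  Following a point from near 0 to near 1 along x0 x1
   induces the doubling map of this circle, and conjugation in F does not change it, since elements
   of F only rescale by powers of 2 near 0 and 1.  Hence H carries every standard dyadic interval
   inside (0,1) affinely onto every other one.

   The conjugate s of x1 is the identity left of a dyadic point and doubles distances just to the
   right of it; by the previous step H has such a squeezing element at every dyadic point.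
   Working from left to right, squeezing shows that every g in F agrees on [1/2, 1-e] with some
   h in H.  If moreover g is the identity near 1, a commutator of h with an element of H that is
   the identity right of a point d and contracts towards d from the left (obtained from s x0^-1)
   agrees with g on all of [1/2,1].  Applied to the conjugator of s, this puts x1 itself in H, and
   x0, x1 generate F: rotations turn every dyadic subdivision into the comb .0, .10, .110, ... *)

(** * Dyadic words *)

Notation word := (list bool).

(* [pt u t] is the point .ut, so [pt u] maps [0,1] affinely onto the standard dyadic interval [u]. *)
Fixpoint pt (u : word) (t : R) : R :=
  match u with
  | [] => t
  | b :: w => ((if b then 1 else 0) + pt w t) / 2
  end.

Lemma pt_app u w t : pt (u ++ w) t = pt u (pt w t).
Proof. induction u as [|b u IH]; simpl; [easy | now rewrite IH]. Qed.

Lemma pow2_pos n : 0 < 2 ^ n.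
Proof. apply pow_lt; lra. Qed.

Lemma pow2_ge1 n : 1 <= 2 ^ n.
Proof. apply pow_R1_Rle; lra. Qed.

Lemma INR_pow2 n : INR (2 ^ n) = 2 ^ n.
Proof. rewrite pow_INR; now replace (INR 2) with 2 by (simpl; lra). Qed.

Lemma pt_affine u t : pt u t = pt u 0 + t / 2 ^ length u.
Proof.
  induction u as [|b u IH]; simpl; [lra|].
  rewrite IH; pose proof (pow2_pos (length u)); field; lra.
Qed.

Lemma pt_range u t : 0 <= t <= 1 -> 0 <= pt u t <= 1.
Proof.
  intros Ht; induction u as [|b u IH]; simpl; [easy|].
  destruct b; lra.
Qed.

Lemma pt_lt u s t : s < t -> pt u s < pt u t.
Proof. intros Hst; induction u as [|b u IH]; simpl; [easy|]. lra. Qed.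

Lemma pt_le u s t : s <= t -> pt u s <= pt u t.
Proof. intros [Hst | ->]; [left; now apply pt_lt | lra]. Qed.

Lemma pt_0_lt1 u : pt u 0 < 1.
Proof. pose proof (pt_range u 1); pose proof (pt_lt u 0 1); lra. Qed.

Lemma pt_1_gt0 u : 0 < pt u 1.
Proof. pose proof (pt_range u 0); pose proof (pt_lt u 0 1); lra. Qed.

Lemma pt_zeros n t : pt (repeat false n) t = t / 2 ^ n.
Proof.
  induction n as [|n IH]; simpl; [lra|].
  rewrite IH; pose proof (pow2_pos n); field; lra.
Qed.

Lemma pt_ones n t : pt (repeat true n) t = 1 - (1 - t) / 2 ^ n.
Proof.
  induction n as [|n IH]; simpl; [lra|].
  rewrite IH; pose proof (pow2_pos n); field; lra.
Qed.

Lemma starts_at_0 u : pt u 0 = 0 -> u = repeat false (length u).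
Proof.
  induction u as [|b u IH]; simpl; intros H; [easy|].
  pose proof (pt_range u 0); destruct b; [lra|].
  rewrite <- IH; [easy | lra].
Qed.

Lemma ends_at_1 u : pt u 1 = 1 -> u = repeat true (length u).
Proof.
  induction u as [|b u IH]; simpl; intros H; [easy|].
  pose proof (pt_range u 1); destruct b; [|lra].
  rewrite <- IH; [easy | lra].
Qed.

Lemma pt_numerator u :
  exists m : nat, (m < 2 ^ length u)%nat /\ forall t, pt u t = (INR m + t) / 2 ^ length u.
Proof.
  induction u as [|b u (m & Hm & IH)]; simpl.
  - exists 0%nat; split; [lia|]; intros t; simpl; lra.
  - exists (m + (if b then 2 ^ length u else 0))%nat; split.
    + destruct b; lia.
    + intros t; rewrite IH, plus_INR; pose proof (pow2_pos (length u)).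
      destruct b; [rewrite INR_pow2 | simpl INR]; field; lra.
Qed.

Lemma word_of_numerator n m :
  (m < 2 ^ n)%nat -> exists u, length u = n /\ forall t, pt u t = (INR m + t) / 2 ^ n.
Proof.
  revert m; induction n as [|n IH]; simpl; intros m Hm.
  - exists []; split; [easy|]; intros t; replace m with 0%nat by lia; simpl; lra.
  - pose proof (pow2_pos n).
    destruct (Nat.lt_ge_cases m (2 ^ n)) as [Hlt | Hge].
    + destruct (IH m Hlt) as (u & Hu & E); exists (false :: u); simpl; split; [now rewrite Hu|].
      intros t; rewrite E; field; lra.
    + destruct (IH (m - 2 ^ n)%nat) as (u & Hu & E); [lia|].
      exists (true :: u); simpl; split; [now rewrite Hu|].
      intros t; rewrite E, minus_INR, INR_pow2 by easy; field; lra.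
Qed.

(** Standard dyadic intervals are nested or have disjoint interiors. Different first letters would
    put the two intervals on opposite sides of 1/2, and [0 < t < 1] rules out a mere common
    endpoint. *)
Lemma prefix_of_overlap u w t :
  (length u <= length w)%nat -> pt u 0 <= pt w t <= pt u 1 -> 0 < t < 1 ->
  exists w', w = u ++ w'.
Proof.
  revert w; induction u as [|b u IH]; intros w Hl Hx Ht; [now exists w|].
  destruct w as [|b' w]; simpl in *; [lia|].
  assert (b = b') as <-.
  { pose proof (pt_lt w 0 t); pose proof (pt_lt w t 1); pose proof (pt_range w 0);
    pose proof (pt_range w 1); pose proof (pt_range u 0); pose proof (pt_range u 1).
    destruct b, b'; try easy; lra. }
  destruct (IH w) as [w' ->]; [lia | lra | easy | now exists w'].
Qed.

Lemma word_through n x : 0 <= x <= 1 ->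
  exists u t, length u = n /\ 0 <= t <= 1 /\ x = pt u t.
Proof.
  revert x; induction n as [|n IH]; intros x Hx; [now exists [], x|].
  destruct (Rle_dec x (1/2)).
  - destruct (IH (2 * x)) as (u & t & Hu & Ht & E); [lra|].
    exists (false :: u), t; simpl; repeat split; try lra; try now rewrite Hu.
  - destruct (IH (2 * x - 1)) as (u & t & Hu & Ht & E); [lra|].
    exists (true :: u), t; simpl; repeat split; try lra; try now rewrite Hu.
Qed.

(** There are finitely many words of length [n], so pointwise bounds become a uniform one. It is
    applied to the lengths of image words when inverting an element of F. *)
Lemma bound_over_words (P : word -> nat -> Prop) n :
  (forall u, length u = n -> exists k, P u k) ->
  exists N, forall u, length u = n -> exists k, (k <= N)%nat /\ P u k.
Proof.
  revert P; induction n as [|n IH]; intros P H.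
  - destruct (H [] eq_refl) as [k Hk]; exists k; intros [|b u] Hu; [now exists k | easy].
  - destruct (IH (fun u => P (false :: u))) as [N0 H0]; [intros; apply H; simpl; lia|].
    destruct (IH (fun u => P (true :: u))) as [N1 H1]; [intros; apply H; simpl; lia|].
    exists (N0 + N1)%nat; intros [|[] u] Hu; [easy| |]; injection Hu as Hu.
    + destruct (H1 u Hu) as (k & Hk & HP); exists k; split; [lia | easy].
    + destruct (H0 u Hu) as (k & Hk & HP); exists k; split; [lia | easy].
Qed.

(** Prefix replacement: on the interval of [u], [f] is the affine map of slope 2^(|u|-|v|) that
    sends .uα to .vα. *)
Definition maps (f : R -> R) (u v : word) : Prop :=
  forall t, 0 <= t <= 1 -> f (pt u t) = pt v t.

Lemma maps_app f u v w : maps f u v -> maps f (u ++ w) (v ++ w).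
Proof. intros H t Ht; rewrite !pt_app; apply H, pt_range, Ht. Qed.

Lemma maps_id u : maps (fun x => x) u u.
Proof. now intros t _. Qed.

Lemma maps_mul f g u v w : maps f u v -> maps g v w -> maps (mulF f g) u w.
Proof. intros Hf Hg t Ht; unfold mulF; now rewrite Hf, Hg. Qed.

Lemma maps_inv f g u v : (forall x, g (f x) = x) -> maps f u v -> maps g v u.
Proof. intros Hg Hf t Ht; now rewrite <- Hf. Qed.

Lemma maps_at f u v x : maps f u v -> pt u 0 <= x <= pt u 1 ->
  f x = pt v 0 + (x - pt u 0) * 2 ^ length u / 2 ^ length v.
Proof.
  intros H Hx; pose proof (pow2_pos (length u)); pose proof (pow2_pos (length v)).
  pose (t := (x - pt u 0) * 2 ^ length u).
  assert (0 <= t <= 1) as Ht.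
  { rewrite (pt_affine u 1) in Hx; unfold t; split; [apply Rmult_le_pos; lra|].
    replace 1 with (1 / 2 ^ length u * 2 ^ length u) by (field; lra).
    apply Rmult_le_compat_r; lra. }
  replace x with (pt u t) at 1.
  - rewrite H, pt_affine by easy; unfold t; field; lra.
  - rewrite pt_affine; unfold t; field; lra.
Qed.

(** * Thompson's group F in terms of words *)

(** Breakpoints are traded for a depth [N] beyond which every standard dyadic interval goes affinely
    onto another one. Composition and inversion then reduce to operations on words. *)
Definition isF (f : R -> R) : Prop :=
  (forall x, x < 0 \/ 1 < x -> f x = x) /\ f 0 = 0 /\ f 1 = 1 /\
  exists N, forall u, (N <= length u)%nat -> exists v, maps f u v.

Lemma isF_of_length f N :
  (forall x, x < 0 \/ 1 < x -> f x = x) -> f 0 = 0 -> f 1 = 1 ->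
  (forall u, length u = N -> exists v, maps f u v) -> isF f.
Proof.
  intros Ho H0 H1 H; repeat split; try easy.
  exists N; intros u Hu; destruct (H (firstn N u)) as [v Hv]; [rewrite length_firstn; lia|].
  exists (v ++ skipn N u); rewrite <- (firstn_skipn N u) at 1; now apply maps_app.
Qed.

(** * Equivalence with the breakpoint description *)

Lemma dyadic_common (a : nat -> R) n : (forall i, (i <= n)%nat -> dyadic (a i)) ->
  exists N, forall i, (i <= n)%nat -> exists m : Z, a i * 2 ^ N = IZR m.
Proof.
  induction n as [|n IH]; intros H.
  - destruct (H 0%nat) as (m & k & E); [lia|]; exists k; intros i Hi.
    replace i with 0%nat by lia; exists m; rewrite E; pose proof (pow2_pos k); field; lra.
  - destruct IH as [N HN]; [intros; apply H; lia|].
    destruct (H (S n)) as (m & k & E); [lia|].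
    exists (N + k)%nat; intros i Hi; rewrite pow_add.
    pose proof (pow2_pos k); pose proof (pow2_pos N).
    destruct (Nat.eq_dec i (S n)) as [-> | Hne].
    + exists (m * 2 ^ Z.of_nat N)%Z; rewrite mult_IZR, <- pow_IZR, E; field; lra.
    + destruct (HN i) as [z Hz]; [lia|].
      exists (z * 2 ^ Z.of_nat k)%Z; rewrite mult_IZR, <- pow_IZR, <- Hz; ring.
Qed.

Lemma slopes_bounded (P : nat -> Z -> Prop) n :
  (forall i, (i < n)%nat -> exists k, P i k) ->
  exists K : nat, forall i, (i < n)%nat -> exists k, (Z.abs k <= Z.of_nat K)%Z /\ P i k.
Proof.
  induction n as [|n IH]; intros H; [exists 0%nat; lia|].
  destruct IH as [K HK]; [intros; apply H; lia|].
  destruct (H n) as [k Hk]; [lia|].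
  exists (K + Z.abs_nat k)%nat; intros i Hi.
  destruct (Nat.eq_dec i n) as [-> | Hne]; [exists k; split; [lia | easy]|].
  destruct (HK i) as (k' & Hk' & HP); [lia|]; exists k'; split; [lia | easy].
Qed.

Lemma locate (a : nat -> R) n x : a 0%nat <= x < a n ->
  exists i, (i < n)%nat /\ a i <= x < a (S i).
Proof.
  induction n as [|n IH]; intros Hx; [lra|].
  destruct (Rlt_dec x (a n)).
  - destruct IH as (i & Hi & Hxi); [lra|]; exists i; split; [lia | easy].
  - exists n; split; [lia | lra].
Qed.

Lemma dyadic_plus x y : dyadic x -> dyadic y -> dyadic (x + y).
Proof.
  intros (m & k & ->) (m' & k' & ->).
  exists (m * 2 ^ Z.of_nat k' + m' * 2 ^ Z.of_nat k)%Z, (k + k')%nat.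
  rewrite plus_IZR, !mult_IZR, <- !pow_IZR, pow_add.
  pose proof (pow2_pos k); pose proof (pow2_pos k'); field; lra.
Qed.

Lemma dyadic_opp x : dyadic x -> dyadic (- x).
Proof.
  intros (m & k & ->); exists (- m)%Z, k; rewrite opp_IZR; pose proof (pow2_pos k); field; lra.
Qed.

Lemma dyadic_scale k x : dyadic x -> dyadic (powerRZ 2 k * x).
Proof.
  intros (m & n & ->); pose proof (pow2_pos n).
  destruct (Z.neg_nonneg_cases k) as [Hk | Hk].
  - exists m, (n + Z.to_nat (- k))%nat.
    replace k with (- Z.of_nat (Z.to_nat (- k)))%Z at 1 by lia.
    rewrite powerRZ_neg', <- pow_powerRZ, pow_add.
    pose proof (pow2_pos (Z.to_nat (- k))); field; lra.
  - exists (m * 2 ^ k)%Z, n.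
    replace k with (Z.of_nat (Z.to_nat k)) by lia.
    rewrite <- pow_powerRZ, mult_IZR, <- pow_IZR; field; lra.
Qed.

Lemma increasing_le (f : R -> R) : (forall x y, x < y -> f x < f y) ->
  forall x y, x <= y -> f x <= f y.
Proof. intros H x y [Hxy | ->]; [left; now apply H | lra]. Qed.

Lemma inF_increasing f : inF f -> forall x y, x < y -> f x < f y.
Proof.
  intros (Ho & H0 & H1 & n & a & Ha0 & Han & _ & Hs).
  assert (forall i, (i <= n)%nat ->
    0 <= a i /\ forall x y, 0 <= x -> x < y -> y <= a i -> f x < f y) as Hi.
  { induction i as [|i IH]; intros Hi; [rewrite Ha0; split; [lra | intros; lra]|].
    destruct IH as [Hp IH]; [lia|]; destruct (Hs i) as [Hlt [k Hk]]; [lia|].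
    split; [lra|]; intros x y Hx Hxy Hy.
    pose proof (powerRZ_lt 2 k ltac:(lra)) as Hpk.
    assert (forall x, a i < x <= a (S i) -> f (a i) < f x) as Hgt.
    { intros z Hz; rewrite (Hk z) by lra.
      pose proof (Rmult_lt_0_compat _ (z - a i) Hpk); lra. }
    destruct (Rle_dec y (a i)) as [Hyi | Hyi]; [now apply IH|].
    destruct (Rle_dec (a i) x) as [Hxi | Hxi].
    - rewrite (Hk x), (Hk y) by lra.
      pose proof (Rmult_lt_compat_l _ (x - a i) (y - a i) Hpk); lra.
    - apply Rlt_trans with (f (a i)); [apply IH; lra | apply Hgt; lra]. }
  destruct (Hi n (le_n n)) as [_ Hm]; rewrite Han in Hm.
  assert (forall x, 0 <= x <= 1 -> 0 <= f x <= 1) as Hr.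
  { intros x Hx; split.
    - destruct (Req_dec x 0) as [-> | Hne]; [lra|].
      rewrite <- H0; left; apply Hm; lra.
    - destruct (Req_dec x 1) as [-> | Hne]; [lra|].
      rewrite <- H1; left; apply Hm; lra. }
  assert (forall x, x < 0 \/ 1 < x \/ 0 <= x <= 1) as Hc by (intros; lra).
  intros x y Hxy; destruct (Hc x) as [Hx | [Hx | Hx]]; destruct (Hc y) as [Hy | [Hy | Hy]];
    try lra; rewrite ?(Ho x), ?(Ho y) by lra; try lra;
    try (pose proof (Hr x Hx)); try (pose proof (Hr y Hy)); try lra.
  apply Hm; lra.
Qed.

Lemma inF_isF f : inF f -> isF f.
Proof.
  intros Hf; pose proof (inF_increasing f Hf) as Hm.
  destruct Hf as (Ho & H0 & H1 & n & a & Ha0 & Han & Hd & Hs).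
  destruct (dyadic_common a n Hd) as [N1 HN1].
  destruct (slopes_bounded (fun i k => forall x, a i <= x <= a (S i) ->
    f x = f (a i) + powerRZ 2 k * (x - a i)) n) as [K HK].
  { intros i Hi; apply Hs, Hi. }
  assert (forall i, (i <= n)%nat -> dyadic (f (a i))) as Hfd.
  { induction i as [|i IH]; intros Hi.
    - rewrite Ha0, H0; exists 0%Z, 0%nat; simpl; lra.
    - destruct (Hs i) as [Hlt [k Hk]]; [lia|]; rewrite Hk by lra.
      apply dyadic_plus; [apply IH; lia|]; apply dyadic_scale.
      apply dyadic_plus; [apply Hd; lia|]; apply dyadic_opp, Hd; lia. }
  destruct (dyadic_common (fun i => f (a i)) n Hfd) as [N2 HN2].
  (* [N1] clears the denominators of the breakpoints and [N2] those of their images, while [K]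
     bounds the exponents of the slopes, so that images of cells of length 2^-N still have depth at
     least [N2]. *)
  apply isF_of_length with (N1 + N2 + K)%nat; try easy.
  set (N := (N1 + N2 + K)%nat); intros u Hu.
  destruct (pt_numerator u) as (j & Hj & Ej); rewrite Hu in Ej, Hj.
  pose proof (pow2_pos N) as HpN.
  assert (forall i, (i <= n)%nat -> exists z : Z, a i * 2 ^ N = IZR z) as HaN.
  { intros i Hi; destruct (HN1 i Hi) as [z Hz]; exists (z * 2 ^ Z.of_nat (N2 + K))%Z.
    rewrite mult_IZR, <- pow_IZR, <- Hz; unfold N; rewrite !pow_add; ring. }
  destruct (locate a n (pt u 0)) as (i & Hi & Hx).
  { rewrite Ha0, Han; pose proof (pt_range u 0); pose proof (pt_0_lt1 u); lra. }
  destruct (HK i Hi) as (k & Hk & Hkf).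
  destruct (HaN i) as [zi Hzi]; [lia|]; destruct (HaN (S i)) as [zs Hzs]; [lia|].
  (* No breakpoint lies inside the cell: over 2^N both the cell and the breakpoints have integer
     numerators, and [j < zs] forces [j + 1 <= zs]. *)
  assert (pt u 1 <= a (S i)) as Hx1.
  { rewrite Ej in Hx |- *.
    assert (INR j < IZR zs) as Hlt.
    { rewrite <- Hzs; destruct Hx as [_ Hx].
      apply (Rmult_lt_compat_r (2 ^ N)) in Hx; [|easy].
      replace (INR j) with ((INR j + 0) / 2 ^ N * 2 ^ N) by (field; lra); exact Hx. }
    rewrite INR_IZR_INZ in *; apply lt_IZR in Hlt.
    apply Rmult_le_reg_r with (2 ^ N); [easy|]; rewrite Hzs.
    replace ((IZR (Z.of_nat j) + 1) / 2 ^ N * 2 ^ N) with (IZR (Z.of_nat j) + 1) by (field; lra).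
    rewrite <- plus_IZR; apply IZR_le; lia. }
  (* Slope 2^k turns length 2^-N into 2^-L; [q] below is the numerator over 2^L of the left end of
     the image cell. *)
  pose (L := Z.to_nat (Z.of_nat N - k)).
  assert (powerRZ 2 k = 2 ^ N / 2 ^ L) as Ek.
  { pose proof (pow2_pos L); apply Rmult_eq_reg_r with (2 ^ L); [|lra].
    rewrite (pow_powerRZ 2 L), <- powerRZ_add by lra.
    replace (k + Z.of_nat L)%Z with (Z.of_nat N) by lia.
    rewrite <- !pow_powerRZ; field; lra. }
  destruct (HN2 i) as [y Hy]; [lia|]; simpl in Hy.
  pose proof (pow2_pos L) as HpL.
  assert (exists e, L = (N2 + e)%nat) as [e He] by (exists (L - N2)%nat; lia).
  pose (q := (y * 2 ^ Z.of_nat e + (Z.of_nat j - zi))%Z).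
  assert (forall t, 0 <= t <= 1 -> f (pt u t) = (IZR q + t) / 2 ^ L) as Hq.
  { intros t Ht; rewrite Hkf.
    2:{ pose proof (pt_le u 0 t); pose proof (pt_le u t 1); lra. }
    rewrite Ek, Ej; unfold q; rewrite plus_IZR, mult_IZR, minus_IZR, <- pow_IZR, <- Hy, <- Hzi.
    rewrite <- INR_IZR_INZ, He, pow_add.
    pose proof (pow2_pos N2); pose proof (pow2_pos e); field; lra. }
  (* The image stays in [0,1] by monotonicity, so [q] is the numerator of an actual word of length
     [L]. *)
  assert (0 <= q < 2 ^ Z.of_nat L)%Z as Hqr.
  { assert (0 <= f (pt u 0) /\ f (pt u 1) <= 1) as [Hge Hle].
    { pose proof (pt_range u 0); pose proof (pt_range u 1).
      pose proof (increasing_le f Hm 0 (pt u 0)); pose proof (increasing_le f Hm (pt u 1) 1); lra. }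
    rewrite Hq in Hge, Hle by lra; split; [apply le_IZR | apply lt_IZR].
    - apply Rmult_le_reg_r with (/ 2 ^ L); [now apply Rinv_0_lt_compat|].
      unfold Rdiv in Hge; lra.
    - rewrite <- pow_IZR.
      apply (Rmult_le_compat_r (2 ^ L)) in Hle; [|lra].
      replace ((IZR q + 1) / 2 ^ L * 2 ^ L) with (IZR q + 1) in Hle by (field; lra); lra. }
  destruct (word_of_numerator L (Z.to_nat q)) as (v & Hv & Ev).
  { apply Nat2Z.inj_lt; rewrite Nat2Z.inj_pow; simpl; lia. }
  exists v; intros t Ht; rewrite Hq, Ev, INR_IZR_INZ, Z2Nat.id by (easy || lia); easy.
Qed.

Lemma isF_inF f : isF f -> inF f.
Proof.
  intros (Ho & H0 & H1 & N & HN); pose proof (pow2_pos N) as HpN.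
  repeat split; try easy; exists (2 ^ N)%nat, (fun i => INR i / 2 ^ N).
  split; [simpl; field; lra|]; split; [rewrite INR_pow2; field; lra|]; split.
  { intros i _; exists (Z.of_nat i), N; now rewrite INR_IZR_INZ. }
  intros i Hi; split; [rewrite S_INR; apply Rmult_lt_compat_r;
    [now apply Rinv_0_lt_compat | lra]|].
  destruct (word_of_numerator N i Hi) as (u & Hu & Eu).
  destruct (HN u) as [v Hv]; [lia|].
  pose proof (pow2_pos (length v)).
  exists (Z.of_nat N - Z.of_nat (length v))%Z; intros x Hx.
  replace (INR i / 2 ^ N) with (pt u 0) in * by (rewrite Eu; field; lra).
  replace (INR (S i) / 2 ^ N) with (pt u 1) in * by (rewrite Eu, S_INR; field; lra).
  rewrite (maps_at f u v x), (maps_at f u v (pt u 0)) by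
    (easy || (pose proof (pt_lt u 0 1); lra)).
  unfold Z.sub; rewrite powerRZ_add, powerRZ_neg', <- !pow_powerRZ, Hu by lra.
  field; lra.
Qed.

Lemma isF_increasing f : isF f -> forall x y, x < y -> f x < f y.
Proof. intros Hf; apply inF_increasing, isF_inF, Hf. Qed.

Lemma isF_le f : isF f -> forall x y, x <= y -> f x <= f y.
Proof. intros Hf; apply increasing_le, isF_increasing, Hf. Qed.

Lemma isF_id : isF (fun x => x).
Proof.
  apply isF_of_length with 0%nat; try easy.
  intros u _; exists u; apply maps_id.
Qed.

Lemma isF_mul f g : isF f -> isF g -> isF (mulF f g).
Proof.
  intros (Ho & H0 & H1 & N & HN) (Ho' & H0' & H1' & N' & HN'); unfold mulF.
  apply isF_of_length with (N + N')%nat.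
  - intros x Hx; rewrite Ho, Ho'; easy.
  - now rewrite H0.
  - now rewrite H1.
  - intros u Hu; rewrite <- (firstn_skipn N u).
    destruct (HN (firstn N u)) as [v Hv]; [rewrite length_firstn; lia|].
    destruct (HN' (v ++ skipn N u)) as [w Hw]; [rewrite length_app, length_skipn; lia|].
    exists w; eapply maps_mul; [apply maps_app, Hv | exact Hw].
Qed.

(** A word [w] longer than every image word [v] of a depth-[N] cell [u] must extend one of them,
    [w = v ++ w'], and [g] then sends it to [u ++ w']. *)
Lemma isF_inv f g : isF f -> (forall x, g (f x) = x) -> (forall x, f (g x) = x) -> isF g.
Proof.
  intros Hf Hgf Hfg; pose proof (isF_increasing f Hf) as Hm.
  destruct Hf as (Ho & H0 & H1 & N & HN).
  destruct (bound_over_words (fun u k => exists v, length v = k /\ maps f u v) N) as [N' HN'].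
  { intros u Hu; destruct (HN u) as [v Hv]; [lia|]; now exists (length v), v. }
  apply isF_of_length with N'.
  - intros x Hx; rewrite <- (Ho x) at 1 by easy; apply Hgf.
  - rewrite <- H0 at 1; apply Hgf.
  - rewrite <- H1 at 1; apply Hgf.
  (* The cell [u] is found by pulling back the midpoint of [w], an interior point, as the prefix
     criterion requires. *)
  - intros w Hw; pose proof (pt_range w (1/2) ltac:(lra)) as Hr.
    destruct (word_through N (g (pt w (1/2)))) as (u & t & Hu & Ht & E).
    { assert (forall x, g x < 0 \/ 1 < g x \/ 0 <= g x <= 1) as Hc by (intros; lra).
      destruct (Hc (pt w (1/2))) as [Hc' | [Hc' | Hc']]; [| |easy];
        apply Hm in Hc'; rewrite Hfg in Hc'; lra. }
    destruct (HN' u Hu) as (k & Hk & v & Hv & Hmv).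
    assert (pt w (1/2) = pt v t) as E' by (rewrite <- (Hmv t Ht), <- E; now rewrite Hfg).
    destruct (prefix_of_overlap v w (1/2)) as [w' ->]; [lia| |lra|].
    { rewrite E'; split; apply pt_le; lra. }
    exists (u ++ w'); apply maps_app, (maps_inv f); easy.
Qed.

(** * The generators *)

Ltac cases_Rdec :=
  repeat match goal with
  | |- context [Rlt_dec ?a ?b] => destruct (Rlt_dec a b)
  | |- context [Rle_dec ?a ?b] => destruct (Rle_dec a b)
  end.

Lemma x0_00 w : maps x0 (false :: false :: w) (false :: w).
Proof. intros t Ht; pose proof (pt_range w t Ht); simpl; unfold x0; cases_Rdec; lra. Qed.

Lemma x0_01 w : maps x0 (false :: true :: w) (true :: false :: w).
Proof. intros t Ht; pose proof (pt_range w t Ht); simpl; unfold x0; cases_Rdec; lra. Qed.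

Lemma x0_1 w : maps x0 (true :: w) (true :: true :: w).
Proof. intros t Ht; pose proof (pt_range w t Ht); simpl; unfold x0; cases_Rdec; lra. Qed.

Lemma x1_0 w : maps x1 (false :: w) (false :: w).
Proof. intros t Ht; pose proof (pt_range w t Ht); simpl; unfold x1; cases_Rdec; lra. Qed.

Lemma x1_100 w : maps x1 (true :: false :: false :: w) (true :: false :: w).
Proof. intros t Ht; pose proof (pt_range w t Ht); simpl; unfold x1; cases_Rdec; lra. Qed.

Lemma x1_101 w : maps x1 (true :: false :: true :: w) (true :: true :: false :: w).
Proof. intros t Ht; pose proof (pt_range w t Ht); simpl; unfold x1; cases_Rdec; lra. Qed.

Lemma x1_11 w : maps x1 (true :: true :: w) (true :: true :: true :: w).
Proof. intros t Ht; pose proof (pt_range w t Ht); simpl; unfold x1; cases_Rdec; lra. Qed.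

Lemma isF_x0 : isF x0.
Proof.
  apply isF_of_length with 2%nat; try (intros; unfold x0; cases_Rdec; lra).
  intros [|[] [|[] w]] Hw; try easy; eexists;
    (apply x0_1 || apply x0_00 || apply x0_01).
Qed.

Lemma isF_x1 : isF x1.
Proof.
  apply isF_of_length with 3%nat; try (intros; unfold x1; cases_Rdec; lra).
  intros [|[] [|[] [|[] w]]] Hw; try easy; eexists;
    (apply x1_11 || apply x1_100 || apply x1_101 || apply x1_0).
Qed.

Definition x0_inv (x : R) : R :=
  if Rlt_dec x 0 then x
  else if Rle_dec x (1/2) then x / 2
  else if Rle_dec x (3/4) then x - 1/4
  else if Rle_dec x 1 then 2 * x - 1
  else x.

Lemma x0_invK x : x0_inv (x0 x) = x.
Proof. unfold x0, x0_inv; cases_Rdec; lra. Qed.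

Lemma x0K_inv x : x0 (x0_inv x) = x.
Proof. unfold x0, x0_inv; cases_Rdec; lra. Qed.

(* For [f] in F this is the identity outside [1/2,1], because [f] is the identity outside [0,1]. *)
Definition copy1 (f : R -> R) (x : R) : R := (1 + f (2 * x - 1)) / 2.

Lemma copy1_x0 : copy1 x0 = x1.
Proof.
  apply functional_extensionality; intros x; unfold copy1, x0, x1; cases_Rdec; lra.
Qed.

Lemma copy1_mul f g : copy1 (mulF f g) = mulF (copy1 f) (copy1 g).
Proof.
  apply functional_extensionality; intros x; unfold copy1, mulF.
  replace (2 * ((1 + f (2 * x - 1)) / 2) - 1) with (f (2 * x - 1)) by lra; reflexivity.
Qed.

Lemma copy1_id : copy1 (fun x => x) = (fun x => x).
Proof. apply functional_extensionality; intros x; unfold copy1; lra. Qed.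

Lemma copy1_cancel f g : (forall x, g (f x) = x) -> forall x, copy1 g (copy1 f x) = x.
Proof.
  intros H x; unfold copy1.
  replace (2 * ((1 + f (2 * x - 1)) / 2) - 1) with (f (2 * x - 1)) by lra.
  rewrite H; lra.
Qed.

Lemma maps_copy1 f u v : maps f u v -> maps (copy1 f) (true :: u) (true :: v).
Proof.
  intros H t Ht; unfold copy1; simpl.
  replace (2 * ((1 + pt u t) / 2) - 1) with (pt u t) by lra.
  now rewrite H.
Qed.

(** * Subgroups of F *)

Record subgroupF (H : (R -> R) -> Prop) : Prop := {
  sub_isF : forall f, H f -> isF f;
  sub_id : H (fun x => x);
  sub_mul : forall f g, H f -> H g -> H (mulF f g);
  sub_inv : forall f, H f ->
    exists g, H g /\ (forall x, g (f x) = x) /\ (forall x, f (g x) = x) }.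

Lemma sub_iter H f n : subgroupF H -> H f -> H (Nat.iter n f).
Proof.
  intros HH Hf; induction n as [|n IH]; [apply (sub_id H HH)|].
  exact (sub_mul H HH _ _ IH Hf).
Qed.

Definition carries (H : (R -> R) -> Prop) (u v : word) : Prop :=
  exists h, H h /\ maps h u v.

Lemma carries_trans H u v w : subgroupF H -> carries H u v -> carries H v w -> carries H u w.
Proof.
  intros HH (f & Hf & Mf) (g & Hg & Mg); exists (mulF f g); split;
    [now apply sub_mul | now apply maps_mul with v].
Qed.

Lemma carries_sym H u v : subgroupF H -> carries H u v -> carries H v u.
Proof.
  intros HH (f & Hf & Mf); destruct (sub_inv H HH f Hf) as (g & Hg & Hgf & _).
  exists g; split; [easy | now apply (maps_inv f)].
Qed.

Lemma carries_app H u v w : carries H u v -> carries H (u ++ w) (v ++ w).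
Proof. intros (f & Hf & Mf); exists f; split; [easy | now apply maps_app]. Qed.

Lemma carries_refl H u : subgroupF H -> carries H u u.
Proof. intros HH; exists (fun x => x); split; [now apply sub_id | apply maps_id]. Qed.

Lemma carries_zeros H n w : subgroupF H -> H x0 ->
  carries H (repeat false n ++ false :: w) (false :: w).
Proof.
  intros HH H0; induction n as [|n IH]; [now apply carries_refl|].
  apply carries_trans with (repeat false n ++ false :: w); [easy | | easy].
  exists x0; split; [easy|]; destruct n; simpl; apply x0_00.
Qed.

Lemma carries_ones H n w : subgroupF H -> H x0 ->
  carries H (true :: w) (repeat true n ++ true :: w).
Proof.
  intros HH H0; induction n as [|n IH]; [now apply carries_refl|].
  apply carries_trans with (repeat true n ++ true :: w); [easy | easy |].
  exists x0; split; [easy|]; destruct n; simpl; apply x0_1.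
Qed.

Lemma carries_01_10 H w : H x0 -> carries H (false :: true :: w) (true :: false :: w).
Proof. intros H0; exists x0; split; [easy | apply x0_01]. Qed.

(** * Transitivity on standard dyadic intervals inside (0,1) *)

Definition inner (u : word) : Prop := 0 < pt u 0 /\ pt u 1 < 1.

(** The two carrying hypotheses delete the letter after 01, so every word starting with 01 shrinks
    to 01. Any other inner word is first brought to that form by [x0], which shortens leading runs
    of equal letters and exchanges 01 with 10. *)
Lemma carries_inner_01 H u : subgroupF H -> H x0 ->
  carries H [false; true; false] [false; true] ->
  carries H [false; true; true] [false; true] ->
  inner u -> carries H u [false; true].
Proof.
  intros HH H0 Hf Ht; unfold inner.
  assert (forall w, carries H (false :: true :: w) [false; true]) as H01.
  { induction w as [|b w IH]; [now apply carries_refl|].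
    apply carries_trans with (false :: true :: w); [easy | | easy].
    destruct b; [apply (carries_app H _ _ w Ht) | apply (carries_app H _ _ w Hf)]. }
  induction u as [|b u IH]; simpl; [lra|]; intros [Hl Hr].
  destruct b, u as [|b u]; simpl in *; try lra; destruct b; simpl in *.
  - apply carries_trans with (true :: u); [easy | |].
    + apply carries_sym, (carries_ones H 1 u); easy.
    + pose proof (pt_range u 0); apply IH; lra.
  - apply carries_trans with (false :: true :: u); [easy | | easy].
    apply carries_sym, carries_01_10; easy.
  - apply H01.
  - apply carries_trans with (false :: u); [easy | |].
    + apply (carries_zeros H 1 u); easy.
    + pose proof (pt_range u 1); apply IH; lra.
Qed.

(** Since [f] fixes 0, the image of a small interval at 0 again starts at 0, so its word consists of
    zeros: near 0, [f] only rescales by a power of 2. *)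
Lemma isF_near_0 f : isF f -> exists N L, forall i,
  maps f (repeat false (N + i)) (repeat false (L + i)).
Proof.
  intros (_ & H0 & _ & N & HN); destruct (HN (repeat false N)) as [v Hv].
  { now rewrite repeat_length. }
  exists N, (length v); intros i; rewrite !repeat_app; apply maps_app.
  rewrite <- (starts_at_0 v); [easy|].
  rewrite <- Hv, pt_zeros by lra; unfold Rdiv; now rewrite Rmult_0_l.
Qed.

Lemma isF_near_1 f : isF f -> exists N L, forall i,
  maps f (repeat true (N + i)) (repeat true (L + i)).
Proof.
  intros (_ & _ & H1 & N & HN); destruct (HN (repeat true N)) as [v Hv].
  { now rewrite repeat_length. }
  exists N, (length v); intros i; rewrite !repeat_app; apply maps_app.
  rewrite <- (ends_at_1 v); [easy|].
  rewrite <- Hv, pt_ones by lra; unfold Rdiv; now rewrite Rminus_diag, Rmult_0_l, Rminus_0_r.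
Qed.

Lemma iter_conjF a g h n x : (forall x, h (g x) = x) -> (forall x, g (h x) = x) ->
  Nat.iter n (conjF a g h) x = g (Nat.iter n a (h x)).
Proof.
  intros Hhg Hgh; induction n as [|n IH]; simpl; [now rewrite Hgh|].
  rewrite IH; unfold conjF, mulF; now rewrite Hhg.
Qed.

Lemma x0x1_00 w : maps (mulF x0 x1) (false :: false :: w) (false :: w).
Proof. eapply maps_mul; [apply x0_00 | apply x1_0]. Qed.

Lemma x0x1_010 w : maps (mulF x0 x1) (false :: true :: false :: w) (true :: false :: w).
Proof. eapply maps_mul; [apply x0_01 | apply x1_100]. Qed.

Lemma x0x1_011 w : maps (mulF x0 x1) (false :: true :: true :: w) (true :: true :: false :: w).
Proof. eapply maps_mul; [apply x0_01 | apply x1_101]. Qed.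

Lemma x0x1_1 w : maps (mulF x0 x1) (true :: w) (true :: true :: true :: w).
Proof. eapply maps_mul; [apply x0_1 | apply x1_11]. Qed.

Lemma x0x1_iter_0 n w :
  maps (Nat.iter n (mulF x0 x1)) (repeat false n ++ false :: w) (false :: w).
Proof.
  revert w; induction n as [|n IH]; intros w; [apply maps_id|].
  change (Nat.iter (S n) (mulF x0 x1)) with (mulF (Nat.iter n (mulF x0 x1)) (mulF x0 x1)).
  apply maps_mul with (false :: false :: w); [|apply x0x1_00].
  replace (repeat false (S n) ++ false :: w) with (repeat false n ++ false :: false :: w);
    [apply IH|].
  cbn [repeat]; rewrite repeat_cons, <- app_assoc; reflexivity.
Qed.

Lemma x0x1_iter_1 n w :
  maps (Nat.iter n (mulF x0 x1)) (true :: w) (repeat true (n + n) ++ true :: w).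
Proof.
  induction n as [|n IH]; [apply maps_id|].
  change (Nat.iter (S n) (mulF x0 x1)) with (mulF (Nat.iter n (mulF x0 x1)) (mulF x0 x1)).
  apply maps_mul with (repeat true (n + n) ++ true :: w); [easy|].
  rewrite Nat.add_succ_r; destruct n; apply x0x1_1.
Qed.

(* On the circle of [x0]-orbits in (0,1), identified with the interval .01, pushing a point from
   near 0 to near 1 by [x0 x1] is the doubling map.  Elements of F act near 0 and near 1 by
   rescaling by a power of 2, i.e. trivially on that circle, so this survives conjugation. *)
Lemma carries_doubling H g h b : subgroupF H -> H x0 ->
  isF g -> isF h -> (forall x, h (g x) = x) -> (forall x, g (h x) = x) ->
  H (conjF (mulF x0 x1) g h) -> carries H [false; true; b] [false; true].
Proof.
  intros HH H0 Fg Fh Hhg Hgh HY.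
  destruct (isF_near_0 h Fh) as (N & L & Hh); destruct (isF_near_1 g Fg) as (P & Q & Hg).
  set (z := mulF x0 x1) in *.
  (* [z] sends .010 to .10 and .011 to .110. Then [P] further steps prepend 2P ones, enough to reach
     the region where [g] is a rescaling. *)
  assert (exists e, maps (Nat.iter P z)
     (if b then [true; true; false] else [true; false]) (repeat true (P + S e) ++ [false])) as [e He].
  { destruct b; [exists (S P) | exists P].
    - replace (repeat true (P + S (S P)) ++ [false])
        with (repeat true (P + P) ++ true :: [true; false]); [apply x0x1_iter_1|].
      replace (P + S (S P))%nat with (P + P + 2)%nat by lia.
      rewrite (repeat_app true (P + P)), <- app_assoc; reflexivity.
    - replace (repeat true (P + S P) ++ [false])
        with (repeat true (P + P) ++ true :: [false]); [apply x0x1_iter_1|].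
      replace (P + S P)%nat with (P + P + 1)%nat by lia.
      rewrite (repeat_app true (P + P)), <- app_assoc; reflexivity. }
  (* [L] steps strip the zeros, one step crosses from .01 to the right half, and [P] steps approach
     1. *)
  assert (maps (Nat.iter (P + S L) z) (repeat false (L + 1) ++ [true; b])
    (repeat true (P + S e) ++ [false])) as Hz.
  { assert (forall x, Nat.iter (P + S L) z x = mulF (mulF (Nat.iter L z) z) (Nat.iter P z) x) as E.
    { intros x; now rewrite Nat.iter_add. }
    intros t Ht; rewrite E; revert t Ht.
    eapply maps_mul; [|exact He]; eapply maps_mul.
    - rewrite repeat_app, <- app_assoc; apply x0x1_iter_0.
    - destruct b; [apply x0x1_011 | apply x0x1_010]. }
  assert (carries H (repeat false (N + 1) ++ [true; b]) (repeat true (Q + S e) ++ [false])) as Hc.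
  { exists (Nat.iter (P + S L) (conjF z g h)); split; [now apply sub_iter|].
    intros t Ht; rewrite iter_conjF by easy.
    rewrite (maps_app h _ _ [true; b] (Hh 1%nat)), Hz, (maps_app g _ _ [false] (Hg (S e))) by easy.
    reflexivity. }
  (* The surplus zeros and ones produced by [h] and [g] are absorbed by powers of [x0], leaving .01b
     carried to .10 and hence to .01. *)
  apply carries_trans with (repeat false (N + 1) ++ [true; b]); [easy | |].
  { rewrite repeat_app, <- app_assoc; apply carries_sym; [easy|].
    apply (carries_zeros H N); easy. }
  apply (carries_trans H _ _ _ HH Hc).
  apply carries_trans with [true; false]; [easy | |].
  - replace (Q + S e)%nat with (Q + e + 1)%nat by lia; rewrite (repeat_app true (Q + e)), <- app_assoc.
    apply carries_sym; [easy|]; apply (carries_ones H (Q + e)); easy.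
  - apply carries_sym, carries_01_10; easy.
Qed.

Lemma carries_inner H g h u v : subgroupF H -> H x0 ->
  isF g -> isF h -> (forall x, h (g x) = x) -> (forall x, g (h x) = x) ->
  H (conjF (mulF x0 x1) g h) -> inner u -> inner v -> carries H u v.
Proof.
  intros HH H0 Fg Fh Hhg Hgh HY Hu Hv.
  assert (forall b, carries H [false; true; b] [false; true]) as Hd.
  { intros b; now apply carries_doubling with g h. }
  apply carries_trans with [false; true]; [easy | |]; [|apply carries_sym; [easy|]];
    apply carries_inner_01; easy.
Qed.

(** * Pushing points towards 1 *)

Lemma half_pow_small e : 0 < e -> exists n, 1 / 2 ^ n < e.
Proof.
  intros He; destruct (pow_lt_1_zero (1/2) ltac:(rewrite Rabs_right; lra) e He) as [n Hn].
  exists n; specialize (Hn n (le_n n)); pose proof (pow2_pos n).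
  unfold Rdiv in *; rewrite Rmult_1_l in *; rewrite pow_inv in Hn.
  rewrite Rabs_right in Hn; [lra|]; left; now apply Rinv_0_lt_compat.
Qed.

Lemma isF_iter f n : isF f -> isF (Nat.iter n f).
Proof.
  intros Hf; induction n as [|n IH]; [apply isF_id|].
  exact (isF_mul _ _ IH Hf).
Qed.

Lemma iter_fixed {A : Type} (f : A -> A) n x : f x = x -> Nat.iter n f x = x.
Proof. intros H; induction n as [|n IH]; simpl; [easy | now rewrite IH]. Qed.

Lemma maps_iter_app f u w n : maps f (u ++ w) u -> maps (Nat.iter n f) (u ++ concat (repeat w n)) u.
Proof.
  intros H; induction n as [|n IH]; cbn [repeat concat].
  - rewrite app_nil_r; apply maps_id.
  - intros t Ht; rewrite Nat.iter_succ_r, app_assoc.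
    rewrite (maps_app f (u ++ w) u _ H) by easy; now apply IH.
Qed.

Lemma maps_iter_app_inv f u w n : maps f u (u ++ w) -> maps (Nat.iter n f) u (u ++ concat (repeat w n)).
Proof.
  intros H; induction n as [|n IH]; cbn [repeat concat].
  - rewrite app_nil_r; apply maps_id.
  - intros t Ht; rewrite Nat.iter_succ, IH by easy.
    rewrite (maps_app f u (u ++ w) _ H) by easy; now rewrite app_assoc.
Qed.

Lemma concat_repeat_single {A : Type} (a : A) n : concat (repeat [a] n) = repeat a n.
Proof. induction n; simpl; congruence. Qed.

Lemma concat_repeat_repeat {A : Type} (a : A) n j :
  concat (repeat (repeat a n) j) = repeat a (j * n).
Proof. induction j as [|j IH]; simpl; [easy | now rewrite IH, repeat_app]. Qed.

(** [k] iterations expand an initial interval below [x] onto [0,1/2], taking [x] past 1/2; [m] more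
    compress [1/2,1] to within 2^-m of 1. *)
Lemma x0_push x y : 0 < x -> y < 1 -> exists n, y < Nat.iter n x0 x.
Proof.
  intros Hx Hy.
  destruct (half_pow_small x Hx) as [k Hk]; destruct (half_pow_small (1 - y)) as [m Hm]; [lra|].
  exists (m + k)%nat; rewrite Nat.iter_add.
  assert (1/2 <= Nat.iter k x0 x) as Hhalf.
  { assert (maps (Nat.iter k x0) ([false] ++ repeat false k) [false]) as Hm0.
    { rewrite <- (concat_repeat_single false k); apply maps_iter_app, (x0_00 []). }
    pose proof (Hm0 1 ltac:(lra)) as E; rewrite pt_app, pt_zeros in E; simpl in E.
    pose proof (pow2_pos k).
    replace (1/2) with (Nat.iter k x0 ((0 + 1 / 2 ^ k) / 2)) by (rewrite E; lra).
    apply (isF_le _ (isF_iter _ k isF_x0)).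
    assert (0 < 1 / 2 ^ k) by (apply Rdiv_lt_0_compat; lra); lra. }
  assert (maps (Nat.iter m x0) [true] ([true] ++ repeat true m)) as Hm1.
  { rewrite <- (concat_repeat_single true m); apply maps_iter_app_inv, (x0_1 []). }
  pose proof (Hm1 0 ltac:(lra)) as E; rewrite pt_app, pt_ones in E; simpl in E.
  apply (isF_le _ (isF_iter _ m isF_x0)) in Hhalf.
  replace ((1 + 0) / 2) with (1/2) in E by lra; rewrite E in Hhalf.
  replace (1 - 0) with 1 in Hhalf by lra; pose proof (pow2_pos m).
  assert (0 < 1 / 2 ^ m) by (apply Rdiv_lt_0_compat; lra); lra.
Qed.

Lemma iter_copy1 f n x : Nat.iter n (copy1 f) x = copy1 (Nat.iter n f) x.
Proof.
  induction n as [|n IH]; [unfold copy1; simpl; lra|].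
  rewrite Nat.iter_succ, IH; unfold copy1; rewrite Nat.iter_succ.
  f_equal; f_equal; f_equal; lra.
Qed.

Lemma x1_push x y : 1/2 < x -> y < 1 -> exists n, y < Nat.iter n x1 x.
Proof.
  intros Hx Hy; destruct (x0_push (2 * x - 1) (2 * y - 1)) as [n Hn]; [lra | lra |].
  exists n; rewrite <- copy1_x0, iter_copy1; unfold copy1; lra.
Qed.

(** * Squeezing elements *)

Lemma inner_maps f u v : isF f -> maps f u v -> inner u -> inner v.
Proof.
  intros Hf Hm [Hl Hr]; pose proof (isF_increasing f Hf) as Hi.
  destruct Hf as (_ & H0 & H1 & _); split.
  - rewrite <- (Hm 0) by lra; pose proof (Hi 0 (pt u 0)); lra.
  - rewrite <- (Hm 1) by lra; pose proof (Hi (pt u 1) 1); lra.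
Qed.

Definition word_transitive (H : (R -> R) -> Prop) : Prop :=
  forall u v, inner u -> inner v -> carries H u v.

(** Modelled on [x1], which has this property for the word 10. [A] itself expands away from
    [pt u 0]; its inverse powers squeeze [u] into tiny initial parts, and its positive powers push
    points right of [pt u 0] towards 1. *)
Definition squeezes (A : R -> R) (u : word) : Prop :=
  (forall x, x <= pt u 0 -> A x = x) /\ maps A (u ++ [false]) u /\
  forall x y, pt u 0 < x -> y < 1 -> exists n, y < Nat.iter n A x.

(** The given conjugate of [x1] already squeezes a word [z] that starts at g(1/2). Conjugating once
    more by an element of [H] carrying [z] to [u] moves this behaviour to [u]. *)
Lemma squeezer H g h u : subgroupF H -> word_transitive H ->
  isF g -> isF h -> (forall x, h (g x) = x) -> (forall x, g (h x) = x) ->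
  H (conjF x1 g h) -> inner u -> exists A, H A /\ squeezes A u.
Proof.
  intros HH Htr Fg Fh Hhg Hgh Hs Hu.
  destruct (Fg) as (_ & Hg0 & Hg1 & N & HN).
  (* This interval starts at 1/2, is small enough for [g] to be affine on it, and begins with 10, so
     that [x1] maps its left half onto it. *)
  pose (w0 := true :: repeat false (S N)).
  destruct (HN w0) as [z Hz]; [unfold w0; simpl; rewrite repeat_length; lia|].
  assert (pt w0 0 = 1/2) as Ew0.
  { unfold w0; cbn [pt]; rewrite pt_zeros; unfold Rdiv; rewrite Rmult_0_l; lra. }
  assert (inner w0) as Iw0.
  { split; [rewrite Ew0; lra|]; unfold w0; simpl.
    pose proof (pt_range (repeat false N) 1); lra. }
  assert (maps (conjF x1 g h) (z ++ [false]) z) as Msz.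
  { unfold conjF; apply maps_mul with w0; [|easy].
    apply maps_mul with (w0 ++ [false]); [apply maps_app, (maps_inv g); easy|].
    unfold w0; cbn [repeat app]; rewrite <- repeat_cons; apply x1_100. }
  destruct (Htr z u) as (e & He & Me); [now apply (inner_maps g w0) | easy |].
  destruct (sub_inv H HH e He) as (ei & Hei & Eei & Eie).
  pose proof (sub_isF H HH e He) as Fe; pose proof (sub_isF H HH ei Hei) as Fei.
  exists (conjF (conjF x1 g h) e ei).
  assert (h (ei (pt u 0)) = 1/2) as Ehalf.
  { rewrite <- (Me 0), Eei, <- (Hz 0), Hhg by lra; exact Ew0. }
  split; [|split; [|split]].
  - unfold conjF at 1; repeat apply sub_mul; easy.
  - intros x Hx; unfold conjF, mulF.
    assert (h (ei x) <= 1/2) as Hx2.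
    { rewrite <- Ehalf; apply (isF_le h Fh), (isF_le ei Fei), Hx. }
    unfold x1; cases_Rdec; try lra; now rewrite Hgh, Eie.
  - apply maps_mul with z; [|easy]; apply maps_mul with (z ++ [false]); [|easy].
    apply maps_app, (maps_inv e); easy.
  - intros x y Hx Hy.
    assert (ei 1 = 1 /\ h 1 = 1) as [Eei1 Eh1].
    { split; [apply Fei | apply Fh]. }
    destruct (x1_push (h (ei x)) (h (ei y))) as [n Hn].
    + rewrite <- Ehalf; apply (isF_increasing h Fh), (isF_increasing ei Fei), Hx.
    + rewrite <- Eh1, <- Eei1 at 1; apply (isF_increasing h Fh), (isF_increasing ei Fei), Hy.
    + exists n; rewrite !iter_conjF by easy.
      rewrite <- (Eie y), <- (Hgh (ei y)).
      apply (isF_increasing e Fe), (isF_increasing g Fg), Hn.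
Qed.

(** * Agreement with elements of F on compact intervals *)

Lemma half_cell_le m n : (m <= n)%nat -> 1 / 2 / 2 ^ n <= 1 / 2 ^ n <= 1 / 2 ^ m.
Proof.
  intros Hl; pose proof (pow2_pos m); pose proof (pow2_pos n).
  assert (2 ^ m <= 2 ^ n) by (apply Rle_pow; [lra | easy]).
  assert (/ 2 ^ n <= / 2 ^ m) by (apply Rinv_le_contravar; easy).
  assert (0 < / 2 ^ n) by now apply Rinv_0_lt_compat.
  unfold Rdiv; lra.
Qed.

(** The midpoint of the deeper interval lies in the other one, so [u] is a prefix of [v]; the
    remaining word starts at 0 and is all zeros. *)
Lemma same_start u v : pt v 0 = pt u 0 -> (length u <= length v)%nat ->
  exists m, v = u ++ repeat false m.
Proof.
  intros E Hl; destruct (prefix_of_overlap u v (1/2) Hl) as [w ->]; [|lra|].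
  - pose proof (pt_lt v 0 (1/2)); pose proof (half_cell_le _ _ Hl); split; [lra|].
    rewrite (pt_affine v), (pt_affine u 1), E; lra.
  - exists (length w); f_equal; apply starts_at_0.
    rewrite pt_app in E; pose proof (pt_range w 0).
    destruct (Rle_lt_or_eq_dec 0 (pt w 0)) as [Hlt | <-]; [lra | | easy].
    pose proof (pt_lt u 0 (pt w 0) Hlt); lra.
Qed.

Lemma same_end u v : pt v 1 = pt u 1 -> (length u <= length v)%nat ->
  exists m, v = u ++ repeat true m.
Proof.
  intros E Hl; destruct (prefix_of_overlap u v (1/2) Hl) as [w ->]; [|lra|].
  - pose proof (pt_lt v (1/2) 1); pose proof (half_cell_le _ _ Hl); split; [|lra].
    rewrite (pt_affine v 1), (pt_affine u 1) in E; rewrite (pt_affine v).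
    unfold Rdiv in *; lra.
  - exists (length w); f_equal; apply ends_at_1.
    rewrite pt_app in E; pose proof (pt_range w 1).
    destruct (Rle_lt_or_eq_dec (pt w 1) 1) as [Hlt | ->]; [lra | | easy].
    pose proof (pt_lt u (pt w 1) 1 Hlt); lra.
Qed.

(* [A^-n h B^m] with [A], [B] squeezing towards the left ends of [u], [v]: replacing [u] by its
   tiny initial part [u0^n], where [h] is affine, makes [h] affine on all of [u]. *)
Lemma extend_agreement H g h a u v : subgroupF H ->
  (forall w, inner w -> exists A, H A /\ squeezes A w) ->
  isF g -> maps g u v -> inner u -> H h ->
  a <= pt u 0 -> (forall x, a <= x <= pt u 0 -> h x = g x) ->
  exists h', H h' /\ forall x, a <= x <= pt u 1 -> h' x = g x.
Proof.
  intros HH Hsq Fg Mg Iu Hh Ha Hagree.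
  pose proof (inner_maps g u v Fg Mg Iu) as Iv.
  assert (h (pt u 0) = pt v 0) as Ec by (rewrite Hagree, Mg by lra; easy).
  destruct (sub_isF H HH h Hh) as (_ & _ & _ & N & HN).
  destruct (HN (u ++ repeat false N)) as [w Hw]; [rewrite length_app, repeat_length; lia|].
  (* The image under [h] starts at [pt v 0]. Padding it with |v| zeros makes it deep enough to be an
     initial part of [v]. *)
  destruct (same_start v (w ++ repeat false (length v))) as [m Hm].
  { rewrite pt_app, pt_zeros; unfold Rdiv; rewrite Rmult_0_l, <- Hw, pt_app, pt_zeros by lra.
    unfold Rdiv; rewrite Rmult_0_l; exact Ec. }
  { rewrite length_app, repeat_length; lia. }
  apply (maps_app h _ _ (repeat false (length v))) in Hw.
  rewrite Hm, <- app_assoc, <- repeat_app in Hw; set (n := (N + length v)%nat) in Hw.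
  destruct (Hsq u Iu) as (A & HA & IA & MA & _).
  destruct (Hsq v Iv) as (B & HB & IB & MB & _).
  destruct (sub_inv H HH _ (sub_iter H A n HH HA)) as (C & HC & CA & AC).
  assert (maps C u (u ++ repeat false n)) as MC.
  { apply (maps_inv (Nat.iter n A)); [easy|].
    rewrite <- concat_repeat_single; now apply maps_iter_app. }
  assert (maps (Nat.iter m B) (v ++ repeat false m) v) as MBm.
  { rewrite <- concat_repeat_single; now apply maps_iter_app. }
  exists (mulF (mulF C h) (Nat.iter m B)); split.
  { repeat apply sub_mul; try easy; now apply sub_iter. }
  (* Left of [u] both correcting factors are the identity, so the old agreement survives; on [u] the
     new element and [g] are both the affine map onto [v]. *)
  intros x Hx; destruct (Rle_dec x (pt u 0)) as [Hl | Hr].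
  - unfold mulF.
    assert (C x = x) as -> by (rewrite <- (iter_fixed A n x) at 1 by (now apply IA); apply CA).
    rewrite Hagree by lra; apply iter_fixed, IB.
    rewrite <- (Mg 0) by lra; now apply (isF_le g Fg).
  - assert (maps (mulF (mulF C h) (Nat.iter m B)) u v) as M.
    { eapply maps_mul; [eapply maps_mul; [exact MC | exact Hw] | exact MBm]. }
    rewrite (maps_at _ u v x M), (maps_at g u v x Mg) by lra; easy.
Qed.

Lemma agreement H g M : subgroupF H -> word_transitive H ->
  (forall w, inner w -> exists A, H A /\ squeezes A w) -> isF g ->
  exists h, H h /\ forall x, 1/2 <= x <= 1 - 1 / 2 ^ M -> h x = g x.
Proof.
  intros HH Htr Hsq Fg; pose proof Fg as (_ & _ & _ & N0 & HN0).
  (* On cells of length 2^-N, [g] is affine and 1 - 2^-M is a grid point; the extra 2 keeps the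
     first cell to the right of 1/2 away from 1. *)
  pose (N := (N0 + M + 2)%nat); pose proof (pow2_pos N) as HpN.
  assert (forall i, 1/2 + (INR i + 1) / 2 ^ N < 1 -> exists u, inner u /\ length u = N /\
    pt u 0 = 1/2 + INR i / 2 ^ N /\ pt u 1 = 1/2 + (INR i + 1) / 2 ^ N) as Hcell.
  { intros i Hi.
    assert (INR (2 ^ (N - 1)) / 2 ^ N = 1/2) as Eh.
    { rewrite INR_pow2; replace N with (S (N - 1)) at 2 by lia; simpl.
      pose proof (pow2_pos (N - 1)); field; lra. }
    destruct (word_of_numerator N (2 ^ (N - 1) + i)) as (u & Hu & Eu).
    { apply INR_lt; rewrite plus_INR, (INR_pow2 N).
      apply (Rmult_lt_compat_r (2 ^ N)) in Hi; [|easy].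
      rewrite <- Eh in Hi; pose proof (pow2_pos (N - 1)).
      replace ((INR (2 ^ (N - 1)) / 2 ^ N + (INR i + 1) / 2 ^ N) * 2 ^ N)
        with (INR (2 ^ (N - 1)) + INR i + 1) in Hi by (field; lra); lra. }
    assert (pt u 0 = 1/2 + INR i / 2 ^ N) as E0 by (rewrite Eu, plus_INR, <- Eh; field; lra).
    assert (pt u 1 = 1/2 + (INR i + 1) / 2 ^ N) as E1 by (rewrite Eu, plus_INR, <- Eh; field; lra).
    exists u; repeat split; try easy; [|now rewrite E1].
    rewrite E0; pose proof (pos_INR i).
    assert (0 <= INR i / 2 ^ N) by (apply Rmult_le_pos; [easy | left; now apply Rinv_0_lt_compat]).
    lra. }
  assert (forall i, 1/2 + INR i / 2 ^ N < 1 ->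
    exists h, H h /\ forall x, 1/2 <= x <= 1/2 + INR i / 2 ^ N -> h x = g x) as Hind.
  { induction i as [|i IH]; intros Hi.
    (* The base case concerns the single point 1/2: carrying the first cell onto its image under [g]
       matches g(1/2). *)
    - destruct (Hcell 0%nat) as (u & Iu & Hu & E0 & E1).
      { unfold N; rewrite pow_add; simpl; pose proof (pow2_ge1 (N0 + M)).
        assert (/ (2 ^ (N0 + M) * (2 * (2 * 1))) <= / 4) by (apply Rinv_le_contravar; lra).
        unfold Rdiv; lra. }
      destruct (HN0 u) as [v Mv]; [lia|].
      destruct (Htr u v Iu (inner_maps g u v Fg Mv Iu)) as (h & Hh & Mh).
      exists h; split; [easy|]; simpl INR in *.
      replace (0 / 2 ^ N) with 0 in * by (field; lra).
      intros x Hx; replace x with (pt u 0) by lra; now rewrite Mh, Mv by lra.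
    - rewrite S_INR in Hi |- *.
      destruct (Hcell i Hi) as (u & Iu & Hu & E0 & E1).
      destruct IH as (h & Hh & Hag).
      { destruct Iu; rewrite <- E0; pose proof (pt_lt u 0 1); lra. }
      destruct (HN0 u) as [v Mv]; [lia|].
      rewrite <- E0 in Hag; rewrite <- E1.
      apply (extend_agreement H g h (1/2) u v); try easy.
      rewrite E0; pose proof (pos_INR i).
      assert (0 <= INR i / 2 ^ N) by (apply Rmult_le_pos; [easy | left; now apply Rinv_0_lt_compat]).
      lra. }
  destruct M as [|M].
  { exists (fun x => x); split; [now apply sub_id|]; simpl; intros x Hx; lra. }
  (* This is the number of grid cells between 1/2 and the required right end. *)
  assert (1/2 + INR (2 ^ (N - 1) - 2 ^ (N - S M)) / 2 ^ N = 1 - 1 / 2 ^ S M) as E.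
  { rewrite minus_INR, !INR_pow2 by (apply Nat.pow_le_mono_r; lia).
    pose proof (pow2_pos (N - S M)); pose proof (pow2_pos M).
    replace (N - 1)%nat with (N - S M + M)%nat by lia.
    replace N with (N - S M + M + 1)%nat at 3 by lia.
    rewrite !pow_add; simpl; field; lra. }
  destruct (Hind (2 ^ (N - 1) - 2 ^ (N - S M))%nat) as (h & Hh & Hag).
  - rewrite E; pose proof (pow2_pos (S M)).
    assert (0 < 1 / 2 ^ S M) by (apply Rdiv_lt_0_compat; lra); lra.
  - exists h; split; [easy|]; rewrite <- E; exact Hag.
Qed.

(** * Agreement up to 1 *)

Lemma maps_self_fixes f u x : maps f u u -> pt u 0 <= x <= pt u 1 -> f x = x.
Proof.
  intros H Hx; rewrite (maps_at f u u x H Hx); pose proof (pow2_pos (length u)); field; lra.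
Qed.

(** Cells are scanned leftwards from 1, starting in the region where [f] is the identity. The scan
    stops at the first cell that is moved; since [p] is moved, it cannot run through to 0. *)
Lemma last_moved_cell f a p : isF f -> maps f (repeat true a) (repeat true a) -> f p <> p ->
  exists u v, pt u 1 < 1 /\ maps f u v /\ u <> v /\ forall x, pt u 1 <= x -> f x = x.
Proof.
  intros Ff Ma Hp; pose proof Ff as (Ho & H0 & H1 & N0 & HN0).
  pose (N := (N0 + a)%nat); pose proof (pow2_pos N) as HpN.
  assert (forall i, (S i <= 2 ^ N)%nat ->
    (forall x, 1 - INR (S i) / 2 ^ N <= x -> f x = x) \/
    exists u v, pt u 1 < 1 /\ maps f u v /\ u <> v /\ forall x, pt u 1 <= x -> f x = x) as Hind.
  { induction i as [|i IH]; intros Hi.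
    - left; intros x Hx; destruct (Rlt_dec 1 x); [apply Ho; lra|].
      apply (maps_self_fixes f (repeat true a)); [easy|]; rewrite !pt_ones.
      pose proof (half_cell_le a N ltac:(unfold N; lia)).
      replace ((1 - 1) / 2 ^ a) with 0 by (unfold Rdiv; lra).
      simpl in Hx; replace ((1 - 0) / 2 ^ a) with (1 / 2 ^ a) by (f_equal; lra); lra.
    - destruct IH as [IH | IH]; [lia | | now right].
      destruct (word_of_numerator N (2 ^ N - S (S i))) as (u & Hu & Eu); [lia|].
      rewrite minus_INR, INR_pow2 in Eu by easy.
      assert (pt u 0 = 1 - INR (S (S i)) / 2 ^ N) as E0 by (rewrite Eu; field; lra).
      assert (pt u 1 = 1 - INR (S i) / 2 ^ N) as E1.
      { rewrite Eu, (S_INR (S i)); field; lra. }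
      rewrite <- E1 in IH; rewrite <- E0.
      destruct (HN0 u) as [v Mv]; [unfold N in Hu; lia|].
      destruct (list_eq_dec Bool.bool_dec u v) as [<- | Hne].
      + left; intros x Hx; destruct (Rle_dec x (pt u 1)); [|apply IH; lra].
        now apply (maps_self_fixes f u).
      + right; exists u, v; repeat split; try easy.
        rewrite E1; pose proof (lt_0_INR (S i) ltac:(lia)).
        assert (0 < INR (S i) / 2 ^ N) by now apply Rdiv_lt_0_compat.
        lra. }
  pose proof (Nat.pow_nonzero 2 N ltac:(lia)).
  destruct (Hind (2 ^ N - 1)%nat) as [Hid | Hex]; [lia | | easy].
  exfalso; apply Hp; replace (S (2 ^ N - 1)) with (2 ^ N)%nat in Hid by lia.
  destruct (Rlt_dec p 0); [apply Ho; lra|]; apply Hid; rewrite INR_pow2.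
  replace (2 ^ N / 2 ^ N) with 1 by (field; lra); lra.
Qed.

(** The last moved cell and its image share their right end, so one of the two words is the other
    followed by ones. Hence [f] or its inverse contracts the larger interval towards that end. *)
Lemma contractor H f a p : subgroupF H -> H f ->
  maps f (repeat true a) (repeat true a) -> f p <> p ->
  exists s z k, H s /\ inner z /\ (forall x, pt z 1 <= x -> s x = x) /\
    maps s z (z ++ repeat true (S k)).
Proof.
  intros HH Hf Ma Hp.
  destruct (last_moved_cell f a p (sub_isF H HH f Hf) Ma Hp) as (u & v & Hlt & Mf & Hne & Hfix).
  assert (pt v 1 = pt u 1) as Ee by (rewrite <- Mf, Hfix by lra; easy).
  assert (exists s z k, H s /\ pt z 1 = pt u 1 /\ (forall x, pt z 1 <= x -> s x = x) /\
    maps s z (z ++ repeat true (S k))) as (s & z & k & Hs & Ez & Fz & Mz).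
  { destruct (Nat.le_gt_cases (length u) (length v)) as [Hl | Hl].
    - destruct (same_end u v Ee Hl) as [[|k] ->]; [now rewrite app_nil_r in Hne|].
      now exists f, u, k.
    - destruct (same_end v u (eq_sym Ee) ltac:(lia)) as [[|k] E];
        [now rewrite app_nil_r in E; subst|].
      destruct (sub_inv H HH f Hf) as (fi & Hfi & Efi & Eif).
      exists fi, v, k; repeat split; try easy.
      + intros x Hx; rewrite <- (Hfix x) at 1 by lra; apply Efi.
      + rewrite <- E; now apply (maps_inv f). }
  (* Passing to the right half keeps the contraction and moves the left end away from 0, which makes
     the word inner. *)
  exists s, (z ++ [true]), k; repeat split; try easy.
  - rewrite pt_app; simpl; pose proof (pt_range z 0); pose proof (pt_lt z 0 ((1 + 0) / 2)); lra.
  - rewrite pt_app; simpl; replace ((1 + 1) / 2) with 1 by lra; lra.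
  - intros x; rewrite pt_app; simpl; replace ((1 + 1) / 2) with 1 by lra; apply Fz.
  - replace ((z ++ [true]) ++ repeat true (S k)) with ((z ++ repeat true (S k)) ++ [true]).
    + now apply maps_app.
    + rewrite <- !app_assoc; f_equal; symmetry; apply (repeat_cons (S k)).
Qed.

(* If [T] squeezes [1/2,d] into [q,d], where [g] and hence [h] are the identity, and fixes [d,1],
   then [T h^-1 T^-1 h] is [h] left of [d] and the identity right of [d]. *)
Lemma commutator_agreement H g h T q d : subgroupF H -> H h -> H T ->
  (forall x, q <= x -> g x = x) -> q <= d ->
  (forall x, 1/2 <= x <= d -> h x = g x) ->
  (forall x, d <= x -> T x = x) -> (forall x, 1/2 <= x <= d -> q <= T x <= d) -> 1/2 <= q ->
  exists k, H k /\ forall x, 1/2 <= x -> k x = g x.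
Proof.
  intros HH Hh HT Hgq Hqd Hag Tfix Tq Hq.
  destruct (sub_inv H HH h Hh) as (hi & Hhi & hih & hhi).
  destruct (sub_inv H HH T HT) as (Ti & HTi & TiT & TTi).
  exists (mulF (mulF (mulF T hi) Ti) h); split; [repeat apply sub_mul; easy|].
  assert (forall x, q <= x <= d -> hi x = x) as Ehi.
  { intros x Hx; rewrite <- (hih x) at 2; now rewrite Hag, Hgq by lra. }
  intros x Hx; unfold mulF; destruct (Rle_dec x d) as [Hxd | Hxd].
  - rewrite Ehi, TiT by (apply Tq; lra); apply Hag; lra.
  - rewrite (Tfix x) by lra.
    assert (Ti (hi x) = hi x) as ->.
    { rewrite <- (TiT (hi x)) at 2; rewrite Tfix; [easy|].
      rewrite <- (Ehi d) at 1 by lra; apply (isF_le hi (sub_isF H HH hi Hhi)); lra. }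
    rewrite hhi, Hgq by lra; easy.
Qed.

(** Supplies the [T] of the commutator argument: a power of [s] contracts [z] to its right end, and
    conjugation by an [e] in [H] stretches [z] over [1/2,q], where [g] is the identity right of
    [q]. *)
Lemma agreement_to_1 H g s z k a : subgroupF H -> word_transitive H -> H x0 ->
  (forall w, inner w -> exists A, H A /\ squeezes A w) -> isF g ->
  H s -> inner z -> (forall x, pt z 1 <= x -> s x = x) ->
  maps s z (z ++ repeat true (S k)) ->
  maps g (repeat true (S a)) (repeat true (S a)) ->
  exists f, H f /\ forall x, 1/2 <= x -> f x = g x.
Proof.
  intros HH Htr Hx0 Hsq Fg Hs Iz Fz Mz Mg.
  pose (q := pt (repeat true (S a)) 0).
  assert (1/2 <= q < 1) as Hq.
  { split; [|apply pt_0_lt1]; unfold q; simpl; pose proof (pt_range (repeat true a) 0); lra. }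
  assert (forall x, q <= x -> g x = x) as Hgq.
  { intros x Hx; destruct (Rlt_dec 1 x); [apply Fg; lra|].
    apply (maps_self_fixes g _ x Mg); fold q; rewrite pt_ones; unfold Rdiv; lra. }
  destruct (Hsq z Iz) as (A & HA & IA & _ & PA).
  (* To build [e], powers of [A] keep [pt z 0] fixed and push [pt z 1] beyond x0^m(q); then x0^-m
     brings [pt z 0] below 1/2 and leaves the image of [pt z 1] above [q]. *)
  destruct (x0_push (1/2) (pt z 0)) as [m Hm]; [lra | apply pt_0_lt1 |].
  pose proof (isF_iter x0 m isF_x0) as Fm.
  pose proof (pt_lt z 0 1 ltac:(lra)) as Hz01.
  destruct (PA (pt z 1) (Nat.iter m x0 q)) as [n Hn]; [easy | |].
  { rewrite <- (iter_fixed x0 m 1) by apply isF_x0; apply (isF_increasing _ Fm); lra. }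
  destruct (sub_inv H HH _ (sub_iter H x0 m HH Hx0)) as (X & HX & XK & KX).
  pose proof (sub_isF H HH X HX) as FX.
  pose (e := mulF (Nat.iter n A) X).
  assert (H e) as He by (apply sub_mul; [| apply sub_iter |]; easy).
  assert (e (pt z 0) < 1/2) as He0.
  { unfold e, mulF; rewrite iter_fixed by (apply IA; lra).
    rewrite <- (XK (1/2)); now apply (isF_increasing X FX). }
  assert (q < e (pt z 1)) as He1.
  { unfold e, mulF; rewrite <- (XK q); now apply (isF_increasing X FX). }
  destruct (sub_inv H HH e He) as (ei & Hei & eie & eei).
  pose proof (sub_isF H HH e He) as Fe; pose proof (sub_isF H HH ei Hei) as Fei.
  pose (d := e (pt z 1)).
  assert (d < 1) as Hd1.
  { unfold d; replace 1 with (e 1) at 2 by apply Fe; apply (isF_increasing e Fe), Iz. }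
  assert (ei q < pt z 1) as Heq by (rewrite <- (eie (pt z 1)); now apply (isF_increasing ei Fei)).
  (* [j] iterations of [s] compress [z] to within 2^-j of its right end, hence past the preimage of
     [q]. *)
  destruct (half_pow_small (pt z 1 - ei q)) as [j Hj]; [lra|].
  pose (T := conjF (Nat.iter j s) e ei).
  destruct (half_pow_small (1 - d)) as [M HM]; [lra|].
  destruct (agreement H g M HH Htr Hsq Fg) as (h & Hh & Hag).
  apply (commutator_agreement H g h T q d); try easy; try lra.
  - unfold T, conjF; repeat apply sub_mul; try easy; now apply sub_iter.
  - unfold d; lra.
  - intros x Hx; apply Hag; lra.
  - intros x Hx; unfold T, conjF, mulF; rewrite iter_fixed; [apply eei|].
    apply Fz; rewrite <- (eie (pt z 1)); now apply (isF_le ei Fei).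
  - intros x Hx; unfold T, conjF, mulF.
    assert (pt z 0 <= ei x <= pt z 1) as Hx'.
    { split; [rewrite <- (eie (pt z 0)) | rewrite <- (eie (pt z 1))]; apply (isF_le ei Fei);
        [lra | apply Hx]. }
    pose proof (maps_iter_app_inv s z _ j Mz) as Mj.
    pose proof (isF_le _ (isF_iter s j (sub_isF H HH s Hs))) as Lj.
    assert (ei q <= Nat.iter j s (ei x) <= pt z 1) as Hin.
    { split.
      - apply Rle_trans with (Nat.iter j s (pt z 0)); [|now apply Lj].
        rewrite Mj by lra.
        (* Each iteration appends k+1 ones, so at least [j] ones have been appended in total. *)
        rewrite concat_repeat_repeat, Nat.mul_succ_r, Nat.add_comm; set (i := (j * k)%nat).
        rewrite pt_app, pt_ones, pt_affine.
        rewrite (pt_affine z 1) in Hj.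
        pose proof (half_cell_le j (j + i) ltac:(lia)) as Hc.
        pose proof (pow2_ge1 (length z)) as Hp1.
        assert ((1 - 0) / 2 ^ (j + i) / 2 ^ length z <= 1 / 2 ^ j).
        { apply Rle_trans with (1 / 2 ^ (j + i)); [|easy].
          replace (1 - 0) with 1 by lra; unfold Rdiv at 1.
          rewrite <- (Rmult_1_r (1 / 2 ^ (j + i))) at 2.
          apply Rmult_le_compat_l.
          - left; apply Rdiv_lt_0_compat; [lra | apply pow2_pos].
          - rewrite <- Rinv_1; apply Rinv_le_contravar; lra. }
        unfold Rdiv in *; lra.
      - rewrite <- (iter_fixed s j (pt z 1)) by (apply Fz; lra); now apply Lj. }
    split; [rewrite <- (eei q); now apply (isF_le e Fe) | now apply (isF_le e Fe)].
Qed.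

(** * Recovering x1 *)

(** The slope at 1 is invariant under conjugation, so it is 1/2 for every conjugate of [x1], as it
    is for [x0]. Composing with the inverse of [x0] therefore gives the identity near 1. *)
Lemma conj_x1_near_1 g h : isF h -> (forall x, h (g x) = x) -> (forall x, g (h x) = x) ->
  exists a, maps (conjF x1 g h) (repeat true (S a)) (repeat true (S (S a))).
Proof.
  intros Fh Hhg Hgh; destruct (isF_near_1 h Fh) as (N & L & Hh).
  exists (N + 1)%nat; unfold conjF.
  replace (S (N + 1)) with (N + 2)%nat by lia; replace (S (N + 2)) with (N + 3)%nat by lia.
  apply maps_mul with (repeat true (L + 3)); [|now apply (maps_inv h)].
  apply maps_mul with (repeat true (L + 2)); [easy|].
  replace (L + 3)%nat with (S (S (S L))) by lia; replace (L + 2)%nat with (S (S L)) by lia.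
  apply x1_11.
Qed.

Lemma x0_moves x : 0 < x < 1 -> x0 x <> x.
Proof. intros Hx; unfold x0; cases_Rdec; lra. Qed.

Lemma x1_fixes x : x <= 1/2 -> x1 x = x.
Proof. intros Hx; unfold x1; cases_Rdec; lra. Qed.

Lemma x1_ge x : 1/2 <= x -> 1/2 <= x1 x.
Proof. intros Hx; unfold x1; cases_Rdec; lra. Qed.

Lemma x1_mem H g h : subgroupF H -> word_transitive H -> H x0 ->
  isF g -> isF h -> (forall x, h (g x) = x) -> (forall x, g (h x) = x) ->
  H (conjF x1 g h) -> H x1.
Proof.
  intros HH Htr Hx0 Fg Fh Hhg Hgh Hs; set (s := conjF x1 g h) in *.
  assert (forall w, inner w -> exists A, H A /\ squeezes A w) as Hsq.
  { intros w Hw; now apply (squeezer H g h). }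
  assert (forall x, x <= g (1/2) -> s x = x) as Sfix.
  { intros x Hx; unfold s, conjF, mulF; rewrite x1_fixes; [apply Hgh|].
    rewrite <- (Hhg (1/2)); now apply (isF_le h Fh). }
  (* The contractor comes from s x0^-1, which is the identity near 1 but moves g(1/2), a point fixed
     by [s] and not by [x0]. *)
  assert (exists t z k, H t /\ inner z /\ (forall x, pt z 1 <= x -> t x = x) /\
    maps t z (z ++ repeat true (S k))) as (t & z & k & Ht & Iz & Fz & Mz).
  { destruct (conj_x1_near_1 g h Fh Hhg Hgh) as [a Ma].
    destruct (sub_inv H HH x0 Hx0) as (X & HX & XK & KX).
    apply (contractor H (mulF s X) (S a) (g (1/2))); [easy | now apply sub_mul | |].
    - apply maps_mul with (repeat true (S (S a))); [easy|].
      apply (maps_inv x0); [easy | apply x0_1].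
    - unfold mulF; rewrite Sfix by lra; intros E.
      apply (x0_moves (g (1/2))); [|rewrite <- E at 1; apply KX].
      pose proof (isF_increasing g Fg 0 (1/2)); pose proof (isF_increasing g Fg (1/2) 1).
      destruct Fg as (_ & E0 & E1 & _); lra. }
  destruct (isF_near_1 g Fg) as (N & L & Mg).
  (* [c] undoes the rescaling of [g] near 1, so the product g c is the identity there. *)
  assert (carries H (repeat true (L + 1)) (repeat true (N + 1))) as (c & Hc & Mc).
  { rewrite !repeat_app; apply carries_trans with [true]; [easy | |];
      [apply carries_sym; [easy|]|]; apply carries_ones; easy. }
  destruct (agreement_to_1 H (mulF g c) t z k N) as (f & Hf & Ef); try easy.
  { apply isF_mul; [easy | now apply (sub_isF H HH)]. }
  { replace (S N) with (N + 1)%nat by lia; now apply maps_mul with (repeat true (L + 1)). }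
  destruct (sub_inv H HH c Hc) as (ci & Hci & cic & cci).
  pose (K := mulF f ci).
  assert (H K) as HK by now apply sub_mul.
  assert (forall x, 1/2 <= x -> K x = g x) as EK.
  { intros x Hx; unfold K, mulF at 1; rewrite Ef by easy; apply cic. }
  destruct (sub_inv H HH K HK) as (Ki & HKi & KiK & KKi).
  (* [K] agrees with [g] on [1/2,1], where [x1] is supported, so undoing the conjugation with [K] in
     place of [g] recovers [x1]. Points left of 1/2 go left of g(1/2), where [s] is the identity. *)
  replace x1 with (mulF (mulF K s) Ki); [repeat apply sub_mul; easy|].
  apply functional_extensionality; intros x; unfold mulF.
  destruct (Rle_dec (1/2) x) as [Hx | Hx].
  - rewrite EK by easy; unfold s, conjF, mulF; rewrite Hhg.
    rewrite <- EK by now apply x1_ge. apply KiK.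
  - rewrite Sfix, KiK, x1_fixes by
      (try lra; rewrite <- EK by lra; apply (isF_le K (sub_isF H HH K HK)); lra); easy.
Qed.

(** * x0 and x1 generate F *)

Definition supported01 (f : R -> R) : Prop :=
  (forall x, x <= 0 \/ 1 <= x -> f x = x) /\ forall x, 0 <= x <= 1 -> 0 <= f x <= 1.

Lemma supported01_x0 : supported01 x0.
Proof. split; intros x Hx; unfold x0; cases_Rdec; lra. Qed.

Lemma supported01_copy1 f : supported01 f -> supported01 (copy1 f).
Proof.
  intros [Ho Hi]; unfold copy1; split; intros x Hx; [rewrite Ho; lra|].
  destruct (Rle_dec (2 * x - 1) 0); [rewrite Ho by lra; lra | specialize (Hi (2 * x - 1)); lra].
Qed.

(** On [1/2,1], [x0] is x -> (1+x)/2, the very rescaling that defines [copy1]. *)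
Lemma copy1_conj_x0 f x : supported01 f -> copy1 (copy1 f) (x0 x) = x0 (copy1 f x).
Proof.
  intros [Ho Hi]; destruct (Rle_dec x (1/2)) as [Hx | Hx]; [|destruct (Rle_dec x 1) as [H1 | H1]].
  - assert (2 * (2 * x0 x - 1) - 1 <= 0) by (unfold x0; cases_Rdec; lra).
    assert (copy1 f x = x) as -> by (unfold copy1; rewrite Ho; lra).
    unfold copy1; rewrite Ho; [lra | left; lra].
  - assert (1/2 <= copy1 f x <= 1) by (unfold copy1; specialize (Hi (2 * x - 1)); lra).
    replace (x0 x) with ((1 + x) / 2) by (unfold x0; cases_Rdec; lra).
    replace (x0 (copy1 f x)) with ((1 + copy1 f x) / 2) by (unfold x0; cases_Rdec; lra).
    unfold copy1 at 1; replace (2 * ((1 + x) / 2) - 1) with x by lra; reflexivity.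
  - replace (x0 x) with x by (unfold x0; cases_Rdec; lra).
    assert (copy1 f x = x) as -> by (unfold copy1; rewrite Ho; lra).
    replace (x0 x) with x by (unfold x0; cases_Rdec; lra).
    unfold copy1; rewrite !Ho; lra.
Qed.

(** The iterated copies are the classical generators x_0, x_1, x_2, ..., with x_(n+1) the conjugate
    of x_n by x_0 for n >= 1. *)
Lemma copies_mem H n : subgroupF H -> H x0 -> H x1 -> H (Nat.iter n copy1 x0).
Proof.
  intros HH H0 H1; destruct n as [|n]; [easy|].
  induction n as [|n IH]; [simpl; now rewrite copy1_x0|].
  destruct (sub_inv H HH x0 H0) as (X & HX & XK & KX).
  replace (Nat.iter (S (S n)) copy1 x0)
    with (conjF (Nat.iter (S n) copy1 x0) x0 X); [unfold conjF; repeat apply sub_mul; easy|].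
  assert (supported01 (Nat.iter n copy1 x0)) as Hsup.
  { clear; induction n; [apply supported01_x0 | now apply supported01_copy1]. }
  apply functional_extensionality; intros x; unfold conjF, mulF.
  rewrite !Nat.iter_succ, <- copy1_conj_x0, KX; easy.
Qed.

(** * Dyadic subdivisions and their reduction to combs *)

Inductive chain (x : R) : list word -> R -> Prop :=
| chain_nil : chain x [] x
| chain_cons v l y : pt v 0 = x -> chain (pt v 1) l y -> chain x (v :: l) y.

Fixpoint comb (n : nat) : list word :=
  match n with
  | 0%nat => []
  | 1%nat => [[]]
  | S m => [false] :: map (cons true) (comb m)
  end.

Lemma chain_app x y z l l' : chain x l y -> chain y l' z -> chain x (l ++ l') z.
Proof.
  induction 1 as [|x v l y E Hc IH]; intros H'; simpl; [easy|].
  constructor; [easy | now apply IH].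
Qed.

Lemma chain_map_cons (b : bool) x l y : chain x l y ->
  chain (((if b then 1 else 0) + x) / 2) (map (cons b) l) (((if b then 1 else 0) + y) / 2).
Proof.
  induction 1 as [|x v l y E Hc IH]; simpl; constructor; [simpl; now rewrite E | exact IH].
Qed.

Lemma chain_right_half l x y : chain x l y -> 1/2 <= x ->
  exists l', l = map (cons true) l' /\ chain (2 * x - 1) l' (2 * y - 1).
Proof.
  induction 1 as [|x v l y E Hc IH]; intros Hx; [exists []; split; [easy | constructor]|].
  pose proof (pt_lt v 0 1 ltac:(lra)); destruct IH as (l' & -> & Hl'); [lra|].
  destruct v as [|[] v]; simpl in E.
  - lra.
  - exists (v :: l'); split; [easy|]; constructor; [lra|].
    simpl in Hl'; replace (2 * ((1 + pt v 1) / 2) - 1) with (pt v 1) in Hl' by lra; easy.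
  - pose proof (pt_0_lt1 v); lra.
Qed.

Lemma chain_maps f l l' x y : Forall2 (maps f) l l' -> chain x l y -> chain (f x) l' (f y).
Proof.
  intros HF; revert x; induction HF as [|u v l l' Hm HF IH]; intros x Hc; inversion Hc; subst;
    constructor.
  - now rewrite Hm by lra.
  - rewrite <- Hm by lra; now apply IH.
Qed.

(** [x0] is affine on every standard dyadic interval except those of the empty word and of 0, and
    both of these start at 0. *)
Lemma chain_x0 x l y : 0 < x -> chain x l y -> exists l', Forall2 (maps x0) l l'.
Proof.
  intros Hx Hc; induction Hc as [|x v l y E Hc IH]; [now exists []|].
  destruct IH as [l' Hl']; [pose proof (pt_lt v 0 1); lra|].
  destruct v as [|[] v]; [simpl in E; lra | |].
  - exists ((true :: true :: v) :: l'); constructor; [apply x0_1 | easy].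
  - destruct v as [|[] v]; [simpl in E; lra | |].
    + exists ((true :: false :: v) :: l'); constructor; [apply x0_01 | easy].
    + exists ((false :: v) :: l'); constructor; [apply x0_00 | easy].
Qed.

Lemma Forall2_maps_mul f g l1 l2 l3 :
  Forall2 (maps f) l1 l2 -> Forall2 (maps g) l2 l3 -> Forall2 (maps (mulF f g)) l1 l3.
Proof.
  intros H; revert l3; induction H as [|u v l1 l2 Hm HF IH]; intros l3 H'; inversion H'; subst;
    constructor; [now apply maps_mul with v | now apply IH].
Qed.

Lemma Forall2_maps_copy1 f l l' :
  Forall2 (maps f) l l' -> Forall2 (maps (copy1 f)) (map (cons true) l) (map (cons true) l').
Proof. induction 1; simpl; constructor; [now apply maps_copy1 | easy]. Qed.

(* Rotate by [x0] until the first interval is .0, then recurse in the right half. *)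
Lemma chain_to_comb l (K : (R -> R) -> Prop) :
  K (fun x => x) -> (forall f g, K f -> K g -> K (mulF f g)) ->
  (forall n, K (Nat.iter n copy1 x0)) -> chain 0 l 1 ->
  exists h, K h /\ (forall x, x <= 0 -> h x = x) /\ Forall2 (maps h) l (comb (length l)).
Proof.
  (* [K] is generalized so that the recursion into the right half can use the predicate of those [f]
     whose [copy1] satisfies [K]. *)
  remember (length l) as n eqn:Hn; revert l K Hn; induction n as [|n IH]; intros l K Hn K1 KM KX Hc.
  { destruct l; [inversion Hc; lra | easy]. }
  destruct l as [|v l]; [easy|]; injection Hn as Hn.
  assert (pt v 0 = 0) as Hv0 by (now inversion Hc).
  apply starts_at_0 in Hv0; revert v Hv0 l Hn Hc; intros v; generalize (length v) as a; intros a.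
  revert v; induction a as [|[|a] IHa]; intros v -> l Hn Hc;
    inversion Hc as [|v' l' y _ Hc' E1 E2]; subst v' l' y.
  - destruct l as [|w l]; simpl in Hn; subst n.
    + exists (fun x => x); repeat split; [easy|]; constructor; [apply maps_id | constructor].
    + simpl in Hc'; inversion Hc' as [|w' l' y E Hc'' E1 E2]; subst.
      pose proof (pt_0_lt1 w); lra.
  - destruct (chain_right_half _ _ _ Hc') as (l' & -> & Hl'); [simpl; lra|].
    simpl in Hl'; replace (2 * ((0 + 1) / 2) - 1) with 0 in Hl' by lra.
    replace (2 * 1 - 1) with 1 in Hl' by lra; rewrite length_map in Hn.
    destruct (IH l' (fun f => K (copy1 f))) as (h & Hh & Lh & Mh); try easy.
    { now rewrite copy1_id. }
    { intros f g Hf Hg; rewrite copy1_mul; now apply KM. }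
    { intros m; exact (KX (S m)). }
    (* Because [h] is the identity on the negative half-line, [copy1 h] is the identity on the first
       interval .0. *)
    exists (copy1 h); split; [easy|]; split.
    { intros x Hx; unfold copy1; rewrite Lh; lra. }
    destruct n as [|n]; [destruct l'; [inversion Hl'; lra | easy]|].
    constructor; [|now apply Forall2_maps_copy1].
    intros t Ht; unfold copy1; simpl; rewrite Lh; lra.
  - destruct (chain_x0 (pt (repeat false (S (S a))) 1) l 1) as [l' Hl']; [apply pt_1_gt0 | easy |].
    assert (Forall2 (maps x0) (repeat false (S (S a)) :: l) (repeat false (S a) :: l')) as HF.
    { constructor; [apply x0_00 | easy]. }
    pose proof (chain_maps _ _ _ _ _ HF Hc) as Hc2.
    replace (x0 0) with 0 in Hc2 by (symmetry; apply isF_x0).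
    replace (x0 1) with 1 in Hc2 by (symmetry; apply isF_x0).
    destruct (IHa (repeat false (S a)) eq_refl l') as (h & Hh & Lh & Mh); [|easy|].
    { rewrite Hn; now apply Forall2_length in Hl'. }
    exists (mulF x0 h); split; [apply KM; [exact (KX 0%nat) | easy]|]; split.
    { intros x Hx; unfold mulF; rewrite (proj1 supported01_x0) by lra; now apply Lh. }
    now apply Forall2_maps_mul with (repeat false (S a) :: l').
Qed.

Fixpoint words (n : nat) : list word :=
  match n with
  | 0%nat => [[]]
  | S n => map (cons false) (words n) ++ map (cons true) (words n)
  end.

Lemma words_length n u : In u (words n) <-> length u = n.
Proof.
  revert u; induction n as [|n IH]; intros u; simpl.
  - destruct u; simpl; intuition easy.
  - rewrite in_app_iff, !in_map_iff; split.
    + intros [(w & <- & Hw) | (w & <- & Hw)]; apply IH in Hw; simpl; lia.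
    + destruct u as [|[] u]; simpl; intros Hu; [easy | right | left];
        exists u; split; try easy; apply IH; lia.
Qed.

Lemma words_chain n : chain 0 (words n) 1.
Proof.
  induction n as [|n IH]; simpl.
  - constructor; [easy | constructor].
  - apply chain_app with (1/2).
    + pose proof (chain_map_cons false _ _ _ IH) as Hc; simpl in Hc.
      now replace ((0 + 0) / 2) with 0 in Hc by lra; replace ((0 + 1) / 2) with (1/2) in Hc by lra.
    + pose proof (chain_map_cons true _ _ _ IH) as Hc; simpl in Hc.
      now replace ((1 + 0) / 2) with (1/2) in Hc by lra; replace ((1 + 1) / 2) with 1 in Hc by lra.
Qed.

Lemma Forall2_maps_unique f g l l' u : Forall2 (maps f) l l' -> Forall2 (maps g) l l' ->
  In u l -> forall t, 0 <= t <= 1 -> f (pt u t) = g (pt u t).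
Proof.
  intros Hf; induction Hf as [|v w l l' Hm HF IH]; intros Hg Hu t Ht; [easy|].
  inversion Hg; subst; destruct Hu as [<- | Hu]; [|now apply IH].
  now rewrite Hm, H2.
Qed.

Lemma x0_x1_generate H f : subgroupF H -> H x0 -> H x1 -> isF f -> H f.
Proof.
  intros HH H0 H1 Ff; pose proof Ff as (Ho & F0 & F1 & N & HN).
  assert (exists l, Forall2 (maps f) (words N) l) as [l Hl].
  { assert (forall u, In u (words N) -> exists v, maps f u v) as Hw.
    { intros u Hu; apply HN; apply words_length in Hu; lia. }
    clear - Hw; induction (words N) as [|u L IH]; [now exists []|].
    destruct IH as [l Hl]; [intros; apply Hw; now right|].
    destruct (Hw u) as [v Hv]; [now left|]; exists (v :: l); now constructor. }
  assert (forall l, chain 0 l 1 -> exists h, H h /\ Forall2 (maps h) l (comb (length l))) as Hcomb.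
  { intros l' Hc; destruct (chain_to_comb l' H) as (h & Hh & _ & Mh); try easy.
    - now apply sub_id.
    - now apply sub_mul.
    - intros n; now apply copies_mem.
    - now exists h. }
  (* The uniform subdivision and its image under [f] have equally many intervals, hence reduce to
     the same comb by [a] and [b] in [H], and f = a b^-1. *)
  destruct (Hcomb _ (words_chain N)) as (a & Ha & Ma).
  pose proof (chain_maps f _ _ _ _ Hl (words_chain N)) as Hc; rewrite F0, F1 in Hc.
  destruct (Hcomb l Hc) as (b & Hb & Mb); rewrite <- (Forall2_length Hl) in Mb.
  destruct (sub_inv H HH b Hb) as (bi & Hbi & bib & bbi).
  assert (Forall2 (maps bi) (comb (length (words N))) l) as Mbi.
  { apply Forall2_flip; eapply Forall2_impl; [|exact Mb].
    intros u v Hm; now apply (maps_inv b). }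
  replace f with (mulF a bi); [now apply sub_mul|].
  pose proof (sub_isF H HH _ (sub_mul H HH _ _ Ha Hbi)) as Fab.
  apply functional_extensionality; intros x.
  assert (x < 0 \/ 1 < x \/ 0 <= x <= 1) as [Hx | [Hx | Hx]] by lra.
  - rewrite (proj1 Fab), Ho by lra; easy.
  - rewrite (proj1 Fab), Ho by lra; easy.
  - destruct (word_through N x Hx) as (u & t & Hu & Ht & ->).
    apply (Forall2_maps_unique _ _ (words N) l); try easy.
    + now apply Forall2_maps_mul with (comb (length (words N))).
    + now apply words_length.
Qed.

(** * Invariable generation *)

Lemma subgroup_is_F H g2 h2 g3 h3 f : subgroupF H -> H x0 ->
  isF g2 -> isF h2 -> (forall x, h2 (g2 x) = x) -> (forall x, g2 (h2 x) = x) ->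
  isF g3 -> isF h3 -> (forall x, h3 (g3 x) = x) -> (forall x, g3 (h3 x) = x) ->
  H (conjF x1 g2 h2) -> H (conjF (mulF x0 x1) g3 h3) -> isF f -> H f.
Proof.
  intros HH H0 Fg2 Fh2 E2 E2' Fg3 Fh3 E3 E3' Hs HY Ff.
  assert (word_transitive H) as Htr by (intros u v Hu Hv; now apply (carries_inner H g3 h3)).
  apply x0_x1_generate; try easy; now apply (x1_mem H g2 h2).
Qed.

Lemma conjF_cancel a b g h : (forall x, h (g x) = x) -> (forall x, g (h x) = x) ->
  (forall x, b (a x) = x) -> forall x, conjF b g h (conjF a g h x) = x.
Proof. intros Hhg Hgh Hba x; unfold conjF, mulF; now rewrite Hhg, Hba, Hgh. Qed.

Lemma isF_conj a g h : isF a -> isF g -> isF h -> isF (conjF a g h).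
Proof. intros Fa Fg Fh; exact (isF_mul _ _ (isF_mul _ _ Fh Fa) Fg). Qed.

Lemma gen_has_inverse S :
  (forall s, S s -> isF s /\ exists t, (forall x, t (s x) = x) /\ forall x, s (t x) = x) ->
  forall f, gen S f ->
  isF f /\ exists g, gen S g /\ (forall x, g (f x) = x) /\ forall x, f (g x) = x.
Proof.
  intros HS f Hf; induction Hf as [s Hs | | f g Hf [Ff (f' & Gf' & Ef & Ef')] Hg [Fg (g' & Gg' & Eg & Eg')]
    | f g Hf [Ff (f' & Gf' & Ef & Ef')] Hgf Hfg].
  - destruct (HS s Hs) as [Fs (t & Hts & Hst)]; split; [easy|]; exists t; repeat split; try easy.
    apply gen_inv with s; [now apply gen_base | easy | easy].
  - split; [apply isF_id|]; exists (fun x => x); repeat split; apply gen_id.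
  - split; [now apply isF_mul|]; exists (mulF g' f'); split; [now apply gen_mul|].
    split; intros x; unfold mulF; [now rewrite Eg, Ef | now rewrite Ef', Eg'].
  - split; [now apply (isF_inv f)|]; now exists f.
Qed.

Theorem theorem3p3 :
  forall g1 h1 g2 h2 g3 h3 : R -> R,
    inF g1 -> (forall x, h1 (g1 x) = x) -> (forall x, g1 (h1 x) = x) ->
    inF g2 -> (forall x, h2 (g2 x) = x) -> (forall x, g2 (h2 x) = x) ->
    inF g3 -> (forall x, h3 (g3 x) = x) -> (forall x, g3 (h3 x) = x) ->
    forall f : R -> R,
      inF f <->
      gen (fun s => s = conjF x0 g1 h1 \/ s = conjF x1 g2 h2 \/
                    s = conjF (mulF x0 x1) g3 h3) f.
Proof.
  intros g1 h1 g2 h2 g3 h3 F1 E1 E1' F2 E2 E2' F3 E3 E3' f.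
  apply inF_isF in F1, F2, F3.
  pose proof (isF_inv g1 h1 F1 E1 E1') as F1'; pose proof (isF_inv g2 h2 F2 E2 E2') as F2';
    pose proof (isF_inv g3 h3 F3 E3 E3') as F3'.
  set (S := fun s => s = conjF x0 g1 h1 \/ s = conjF x1 g2 h2 \/ s = conjF (mulF x0 x1) g3 h3).
  assert (forall x, copy1 x0_inv (x1 x) = x) as X1.
  { rewrite <- copy1_x0; apply copy1_cancel, x0_invK. }
  assert (forall x, x1 (copy1 x0_inv x) = x) as X1'.
  { rewrite <- copy1_x0; apply copy1_cancel, x0K_inv. }
  assert (forall f, gen S f ->
    isF f /\ exists g, gen S g /\ (forall x, g (f x) = x) /\ forall x, f (g x) = x) as Hgen.
  { apply gen_has_inverse; intros s [-> | [-> | ->]];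
      (split; [apply isF_conj; auto using isF_mul, isF_x0, isF_x1|]).
    - exists (conjF x0_inv g1 h1); split; apply conjF_cancel; try easy;
        [apply x0_invK | apply x0K_inv].
    - exists (conjF (copy1 x0_inv) g2 h2); split; apply conjF_cancel; easy.
    - exists (conjF (mulF (copy1 x0_inv) x0_inv) g3 h3); split; apply conjF_cancel; try easy;
        intros x; unfold mulF; [now rewrite X1, x0_invK | now rewrite x0K_inv, X1']. }
  split; [|intros Hf; apply isF_inF; now apply Hgen].
  intros Hf; apply inF_isF in Hf.
  assert (forall f, conjF (conjF f h1 g1) g1 h1 = f) as Econj.
  { intros k; apply functional_extensionality; intros x; unfold conjF, mulF; now rewrite !E1'. }
  rewrite <- (Econj f).
  (* Normalization to g1 = 1: the generated group is conjugated by g1^-1, so it contains [x0], and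
     the other conjugators become g2 g1^-1 and g3 g1^-1. *)
  apply (subgroup_is_F (fun k => gen S (conjF k g1 h1))
    (mulF g2 h1) (mulF g1 h2) (mulF g3 h1) (mulF g1 h3)); try (now apply isF_mul);
    try (intros x; unfold mulF; now rewrite ?E1', ?E2, ?E3, ?E2', ?E3', ?E1, ?E1').
  - split.
    + intros k Hk; destruct (Hgen _ Hk) as [Fk _].
      replace k with (conjF (conjF k g1 h1) h1 g1); [now apply isF_conj|].
      apply functional_extensionality; intros x; unfold conjF, mulF; now rewrite !E1.
    + replace (conjF (fun x => x) g1 h1) with (fun x : R => x); [apply gen_id|].
      apply functional_extensionality; intros x; unfold conjF, mulF; now rewrite E1'.
    + intros a b Ha Hb; replace (conjF (mulF a b) g1 h1) with (mulF (conjF a g1 h1) (conjF b g1 h1));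
        [now apply gen_mul|].
      apply functional_extensionality; intros x; unfold conjF, mulF; now rewrite E1.
    + intros k Hk; destruct (Hgen _ Hk) as [_ (j & Gj & Hjk & Hkj)].
      exists (conjF j h1 g1); rewrite Econj; repeat split; [easy| |]; intros x; unfold conjF, mulF.
      * specialize (Hjk (g1 x)); unfold conjF, mulF in Hjk; rewrite E1 in Hjk.
        rewrite Hjk; apply E1.
      * specialize (Hkj (g1 x)); unfold conjF, mulF in Hkj; rewrite <- (E1 (k _)), Hkj; apply E1.
  - apply gen_base; now left.
  - apply gen_base; right; left.
    apply functional_extensionality; intros x; unfold conjF, mulF; now rewrite !E1'.
  - apply gen_base; right; right.
    apply functional_extensionality; intros x; unfold conjF, mulF; now rewrite !E1'.
  - now apply isF_conj.
Qed.
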